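(* Let $n\ge1$ and $D>0$, and assume the following uniform thin-shell bound in $\mathbb{R}^n$: \[ \bar\sigma_n^2\le2D. \] Let $\mu$ be an isotropic log-concave probability measure on $\mathbb{R}^n$ and $X\sim\mu$. Then for every $\varepsilon\in(0,1)$, \[ \mu\left(|X|\le\varepsilon\sqrt n\right)\le\exp\left\{-\frac{n}{2D}\left(1-\varepsilon^2+\varepsilon^2\log\varepsilon^2\right)\right\}. \] Equivalently, setting $s=(1-\varepsilon)\sqrt n$, for all $s\in(0,\sqrt n)$, \[ \mu\left(|X|\le\sqrt n-s\right)\le\exp\left\{-\frac{s^2}{D}\left(1+O\left(\frac{s}{\sqrt n}\right)\right)\right\}, \] where $O(s/\sqrt n)$ denotes a quantity bounded in absolute value by $Cs/\sqrt n$ for a universal constant $C>0$.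
   Context: $|\cdot|$ is the Euclidean norm. A log-concave probability measure on $\mathbb{R}^n$ is a probability measure having a density $f$ with $\log f$ concave. $\operatorname{Cov}(\mu)=\mathbb{E}(X-\mathbb{E}X)\otimes(X-\mathbb{E}X)$ for $X\sim\mu$; $\mu$ is isotropic if $\mathbb{E}X=0$ and $\operatorname{Cov}(\mu)=\operatorname{Id}$. The thin-shell parameter is $\bar\sigma_n^2:=\sup\frac1n\operatorname{Var}_{X\sim\mu}(|X|^2)$, the supremum being over all isotropic log-concave probability measures $\mu$ on $\mathbb{R}^n$. A universal constant is one independent of $n$ and all other parameters. *)

(* Defs.v *)
From HB Require Import structures.
From mathcomp Require Import all_boot all_order all_algebra.
From mathcomp Require Import all_classical all_reals all_analysis.

Set Implicit Arguments.
Unset Strict Implicit.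
Unset Printing Implicit Defensive.

Import Order.TTheory GRing.Theory Num.Theory.
Import numFieldNormedType.Exports.

Local Open Scope classical_set_scope.
Local Open Scope ring_scope.

(* R^n is n.-tuple R with the library's product sigma-algebra, which is the
   Borel sigma-algebra of R^n. *)

Section lebesgue_n.
Local Open Scope ereal_scope.
Context (R : realType).

Definition tcons n (p : measurableTypeR R * n.-tuple R) : n.+1.-tuple R :=
  [tuple of (p.1 : R) :: p.2].

(* Lebesgue measure on R^n: the n-fold product of the Lebesgue measure of R,
   transported along R * R^m -> R^m.+1; lebesgue_n_box below characterizes it. *)
Fixpoint lebesgue_n n : set (n.-tuple R) -> \bar R :=
  if n is m.+1
  then pushforward (@lebesgue_measure R \x lebesgue_n (n:=m)) (@tcons m)
  else \d_[tuple].

Lemma measurable_tcons n : measurable_fun [set: measurableTypeR R * n.-tuple R] (@tcons n).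
Proof.
apply: measurable_cons; [exact: measurable_fst | exact: measurable_snd].
Qed.

Let tuncons n (t : n.+1.-tuple R) : measurableTypeR R * n.-tuple R :=
  (tnth t ord0 : measurableTypeR R, [tuple of behead t]).

Let tconsK n : cancel (@tcons n) (@tuncons n).
Proof. by move=> [x t]; congr pair; apply: val_inj. Qed.

Let tunconsK n : cancel (@tuncons n) (@tcons n).
Proof. by move=> t; rewrite [RHS]tuple_eta. Qed.

Let measurable_tuncons n : measurable_fun setT (@tuncons n).
Proof.
apply: measurable_fun_pair; first exact: measurable_tnth.
exact: measurable_behead.
Qed.

Let preimage_tcons n (A : set (n.+1.-tuple R)) :
  measurable A -> measurable (@tcons n @^-1` A).
Proof.
by move=> mA; rewrite -[X in measurable X]setTI; exact: measurable_tcons.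
Qed.

Section step.
Variables (n : nat) (m : {sigma_finite_measure set (n.-tuple R) -> \bar R}).

Let pm : {measure set (measurableTypeR R * n.-tuple R)%type -> \bar R} :=
  @lebesgue_measure R \x m.
Let L : set (n.+1.-tuple R) -> \bar R := pushforward pm (@tcons n).

Let L0 : L set0 = 0.
Proof. by rewrite /L /pushforward preimage_set0 measure0. Qed.

Let L_ge0 A : 0 <= L A.
Proof. exact: (measure_ge0 pm). Qed.

Let L_sigma_additive : semi_sigma_additive L.
Proof.
move=> F mF tF mUF; rewrite /L /pushforward preimage_bigcup.
apply: measure_semi_sigma_additive.
- by move=> k; exact: preimage_tcons.
- apply/trivIsetP => /= i j _ _ ij; rewrite -preimage_setI.
  by move/trivIsetP : tF => /(_ _ _ _ _ ij) ->//; rewrite preimage_set0.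
- by rewrite -preimage_bigcup; exact: preimage_tcons.
Qed.

Let L_sigma_finite : sigma_finite setT L.
Proof.
have [F [UF ndF Foo]] :=
  (sigma_finiteP _ _).1 (sigma_finiteT (@lebesgue_measure R)).
have [G [UG ndG Goo]] := (sigma_finiteP _ _).1 (sigma_finiteT m).
exists (fun k => @tuncons n @^-1` (F k `*` G k)).
  rewrite -preimage_bigcup -[LHS](preimage_setT (@tuncons n)).
  congr (_ @^-1` _); rewrite -setXTT UF UG.
  apply/seteqP; split=> [[x y]/= [[i _ Fx] [j _ Gy]]|].
    exists (maxn i j) => //; split.
      by move: x Fx; exact/subsetPset/ndF/leq_maxl.
    by move: y Gy; exact/subsetPset/ndG/leq_maxr.
  by move=> [x y] [k _ [/= ? ?]]; split; exists k.
move=> k; have [mFk Fkoo] := Foo k; have [mGk Gkoo] := Goo k.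
have mFG : measurable (F k `*` G k) by exact: measurableX.
split; first by rewrite -[X in measurable X]setTI; exact: measurable_tuncons.
rewrite /L /pushforward/= -comp_preimage (_ : @tuncons n \o _ = id).
  by rewrite preimage_id product_measure1E// lte_mul_pinfty// ge0_fin_numE.
by apply/funext => x /=; rewrite tconsK.
Qed.

Lemma lebesgue_n_step :
  exists m' : {sigma_finite_measure set (n.+1.-tuple R) -> \bar R},
    pushforward (@lebesgue_measure R \x m) (@tcons n) = m'.
Proof.
pose Lm := isMeasure.Build _ _ _ L L0 L_ge0 L_sigma_additive.
pose M : {measure set (n.+1.-tuple R) -> \bar R} := HB.pack L Lm.
pose Ls := Measure_isSigmaFinite.Build _ _ _ M L_sigma_finite.
pose S : {sigma_finite_measure set (n.+1.-tuple R) -> \bar R} := HB.pack L Lm Ls.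
by exists S.
Qed.

End step.

Let lebesgue_n_measure n :
  exists m : {sigma_finite_measure set (n.-tuple R) -> \bar R},
    @lebesgue_n n = m.
Proof.
elim: n => [|n [m mE]]; last by rewrite /= mE; exact: lebesgue_n_step.
by exists (\d_[tuple] : {sigma_finite_measure set (0.-tuple R) -> \bar R}).
Qed.

Let lebesgue_n0 n : @lebesgue_n n set0 = 0.
Proof. by have [m ->] := lebesgue_n_measure n; exact: measure0. Qed.

Let lebesgue_n_ge0 n A : 0 <= @lebesgue_n n A.
Proof. by have [m ->] := lebesgue_n_measure n; exact: measure_ge0. Qed.

Let lebesgue_n_sigma_additive n : semi_sigma_additive (@lebesgue_n n).
Proof.
have [m ->] := lebesgue_n_measure n; exact: measure_semi_sigma_additive.
Qed.

Let lebesgue_n_sigma_finite n : sigma_finite setT (@lebesgue_n n).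
Proof. by have [m ->] := lebesgue_n_measure n; exact: sigma_finiteT. Qed.

HB.instance Definition _ n := isMeasure.Build _ _ _ (@lebesgue_n n)
  (@lebesgue_n0 n) (@lebesgue_n_ge0 n) (@lebesgue_n_sigma_additive n).
HB.instance Definition _ n := Measure_isSigmaFinite.Build _ _ _ (@lebesgue_n n)
  (@lebesgue_n_sigma_finite n).

Lemma lebesgue_n_box n (A : 'I_n -> set R) : (forall i, measurable (A i)) ->
  lebesgue_n [set x : n.-tuple R | forall i, A i (tnth x i)] =
  \prod_(i < n) @lebesgue_measure R (A i).
Proof.
elim: n A => [A _|n IH A mA].
  by rewrite big_ord0 /= diracE mem_set// => -[].
rewrite big_ord_recl -IH// -product_measure1E; first last.
- rewrite (_ : [set _ | _] = \bigcap_i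
      ((fun x : n.-tuple R => tnth x i) @^-1` A (lift ord0 i))).
    apply: fin_bigcap_measurable => // i _.
    by rewrite -[X in measurable X]setTI; exact: measurable_tnth.
  by apply/seteqP; split=> x /= Ax i; [move=> _; exact: Ax|exact: (Ax i)].
- exact: mA.
rewrite /= /pushforward; congr ((_ \x lebesgue_n (n:=n)) _).
apply/seteqP; split=> -[x t] /=.
  move=> At; split=> [|i]; first exact: (At ord0).
  by have := At (lift ord0 i); rewrite tnthS.
move=> [Ax At] i; have [j ->|->//] := unliftP ord0 i.
by rewrite tnthS; exact: At.
Qed.

End lebesgue_n.
Arguments lebesgue_n {R n}.

Section log_concave.
Context (R : realType) (n : nat).
Implicit Types (x y : n.-tuple R) (mu : probability (n.-tuple R) R).

Definition enorm x : R := Num.sqrt (\sum_(i < n) tnth x i ^+ 2).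

Definition tconv (t : R) x y : n.-tuple R :=
  [tuple t * tnth x i + (1 - t) * tnth y i | i < n].

(* log f takes values in [-oo, +oo), with lne 0 = -oo; at the endpoints t = 0
   and t = 1 the convention 0 * -oo = 0 makes the inequality trivial. *)
Definition log_concave (f : n.-tuple R -> R) := forall (t : R) x y,
  0 <= t <= 1 ->
  (t%:E * lne (f x)%:E + (1 - t)%:E * lne (f y)%:E
   <= lne (f (tconv t x y))%:E)%E.

Definition log_concave_measure mu := exists f : n.-tuple R -> R,
  [/\ measurable_fun setT f, (forall x, 0 <= f x), log_concave f &
   forall A, measurable A ->
     mu A = (\int[lebesgue_n]_(x in A) (f x)%:E)%E].

Definition isotropic mu :=
  (forall i : 'I_n, 'E_mu[fun x => tnth x i] = 0)%E /\
  (forall i j : 'I_n,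
    covariance mu (fun x => tnth x i) (fun x => tnth x j) = ((i == j)%:R)%:E).

End log_concave.

(* The squared thin-shell parameter. *)
Definition thin_shell2 (R : realType) (n : nat) : \bar R :=
  ereal_sup [set (n%:R^-1)%:E * variance mu (fun x => (enorm x ^+ 2)%R)
            | mu in [set mu : probability (n.-tuple R) R |
                      log_concave_measure mu /\ isotropic mu]]%E.

(* Main.v *)
Require Import Defs.
From HB Require Import structures.
From mathcomp Require Import all_boot all_order all_algebra all_fingroup.
From mathcomp Require Import all_classical all_reals all_analysis.
From mathcomp Require Import measurable_realfun ring lra.

(** Let [mu] be isotropic and log-concave, and write [r(x) = |x|^2].  The proof
    follows the Gaussian tilts [mu_t], of density proportional to
    [exp (- t r / 2)] with respect to [mu], for [t >= 0].  Let [Z(t)] be the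
    normalizing constant, [h(t)] the mean of [r] under [mu_t] and [L(t)] the
    logarithm of the determinant of the covariance matrix of [mu_t].

    Tilting keeps log-concavity, so an affine image of [mu_t] is isotropic and
    log-concave, and the thin-shell bound applies to it.  If [q] is the squared
    norm of this whitened vector, then [Var q <= 2 D n] under [mu_t].
    Differentiation gives [L' = - Cov (q, r) / 2] and [h' = - Var r / 2], hence
    [0 <= Var (q - r)] says that [L - h / 2 + D n t / 2] is nondecreasing
    ([key_inequality]).  At [t = 0] its value is [- n / 2].  By the arithmetic-geometric
    mean inequality [L <= n ln v] with [v = h / n] ([ln_det_moment_le]), so
    [ln v >= (v - 1) / 2 - D t / 2]; as [ln v <= v - 1], this forces
    [ln v >= - D t], that is [h(t) >= n exp (- D t)] ([second_moment_ge]).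

    Since [(ln Z)' = - h / 2], integration yields
    [ln Z(t) <= - (n / (2 D)) (1 - exp (- D t))] ([laplace_le]).  Chernoff's
    inequality at [t = - ln (eps ^ 2) / D] is the first bound.  The second one
    follows with [theta = - s / (2 sqrt n)], from [x ln x >= (x ^ 2 - 1) / 2] on
    [(0, 1)].

    Two devices keep the matrix calculus short.  The covariance matrix is
    replaced by the matrix [N(t)] of the integrals of [y_i y_j exp (- t r / 2)],
    where [y = (1, x)]: its entries are single integrals and
    [ln det N = L + (n + 1) ln Z].  The whitening map is read off the Cholesky
    factor of [N(t)]; it is lower triangular, so the change of variables that it
    needs follows from Fubini's theorem by induction on the dimension
    ([lebesgue_n_aff]). *)

Set Implicit Arguments.
Unset Strict Implicit.
Unset Printing Implicit Defensive.

Import Order.TTheory GRing.Theory Num.Theory.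
Import numFieldNormedType.Exports.

Local Open Scope classical_set_scope.
Local Open Scope ring_scope.

(** * Cholesky factorization *)

(** Symmetric positive definite matrices. *)
Definition posdef (R : numDomainType) n (N : 'M[R]_n) :=
  N^T = N /\ forall u : 'rV_n, u != 0 -> 0 < (u *m N *m u^T) 0 0.

(** The Cholesky factor [S] comes with its inverse [T], which is triangular too. *)
Lemma cholesky (R : rcfType) n (N : 'M[R]_n) : posdef N ->
  exists S T : 'M[R]_n, [/\ is_trig_mx S, is_trig_mx T,
    forall i, 0 < T i i /\ S i i = (T i i)^-1, S *m T = 1%:M & N = S *m S^T].
Proof.
elim: n N => [|n IH] N [symN pN].
  exists 1%:M, 1%:M; split; rewrite ?scalar_mx_is_trig ?mulmx1//.
  - by case.
  - by apply/matrixP => -[].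
pose N1 := N : 'M[R]_(1 + n).
pose a := N 0 0; pose b := dlsubmx N1 : 'cV[R]_n; pose C := drsubmx N1.
have aE : ulsubmx N1 = a%:M.
  by apply/matrixP => i j; rewrite !ord1 !mxE eqxx mulr1n; congr (N _ _); apply: val_inj.
have urE : ursubmx N1 = b^T by rewrite /b trmx_dlsub [N1^T]symN.
have CT : C^T = C by rewrite /C trmx_drsub [N1^T]symN.
have N1E : N1 = block_mx a%:M b^T b C by rewrite -aE -urE submxK.
have q (x : R) (v : 'rV_n) : (row_mx x%:M v *m N1 *m (row_mx x%:M v)^T) 0 0 =
    x ^+ 2 * a + 2 * x * (v *m b) 0 0 + (v *m C *m v^T) 0 0.
  rewrite N1E mul_row_block tr_row_mx mul_row_col tr_scalar_mx !mulmxDl.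
  rewrite -!scalar_mxM !mul_scalar_mx -scalemxAl !mul_mx_scalar -[b^T *m v^T]trmx_mul.
  rewrite !mxE eqxx mulr1n. ring.
have a0 : 0 < a.
  have := pN (row_mx 1%:M 0); rewrite q !mul0mx !mxE mulr0 !addr0 expr1n mul1r.
  apply; apply/eqP => /matrixP/(_ 0 0); rewrite !mxE.
  case: splitP => //= j _; rewrite !mxE ord1 eqxx => /eqP.
  by rewrite oner_eq0.
pose s := Num.sqrt a.
have s0 : 0 < s by rewrite sqrtr_gt0.
have s2 : s * s = a by rewrite -expr2 sqr_sqrtr// ltW.
(* The Schur complement of the corner [a] is again positive definite. *)
have pM : posdef (C - a^-1 *: (b *m b^T)).
  split.
    by rewrite linearB/= linearZ/= trmx_mul trmxK CT.
  move=> v v0.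
  (* For fixed [v] this choice of the first coordinate minimizes the form. *)
  have := pN (row_mx (- (a^-1 * (v *m b) 0 0))%:M v).
  have -> : ((v *m (C - a^-1 *: (b *m b^T))) *m v^T) 0 0 =
    (v *m C *m v^T) 0 0 - a^-1 * (v *m b) 0 0 ^+ 2.
    rewrite mulmxBr mulmxBl -scalemxAr -scalemxAl !mulmxA -(mulmxA (v *m b)) -[b^T *m v^T]trmx_mul.
    rewrite [in LHS]mxE; congr (_ + _); rewrite 2![in LHS]mxE; congr (- (_ * _)).
    by rewrite [in LHS]mxE big_ord_recl big_ord0 addr0 [X in _ * X]mxE expr2.
  rewrite q; set y := (v *m b) 0 0; set z := (v *m C *m v^T) 0 0.
  move=> H; have : row_mx (- (a^-1 * y))%:M v != 0.
    apply: contra_neq v0 => /(congr1 rsubmx); rewrite row_mxKr => ->.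
    by apply/matrixP => i j; rewrite !mxE.
  move=> /H.
  have -> : (- (a^-1 * y)) ^+ 2 * a + 2 * - (a^-1 * y) * y + z = z - a^-1 * y ^+ 2.
    by field; rewrite gt_eqF.
  by [].
have [S [T [tS tT pT ST NE]]] := IH _ pM.
pose S1 := block_mx s%:M 0 (s^-1 *: b) S : 'M[R]_(1 + n).
pose T1 := block_mx (s^-1)%:M 0 (- (a^-1) *: (T *m b)) T : 'M[R]_(1 + n).
have TS : T *m S = 1%:M by exact: mulmx1C.
exists S1, T1; split.
- by apply: etrans (@is_trig_block_mx _ 1 n 1 n _ _ _ _ erefl) _; rewrite eqxx scalar_mx_is_trig tS.
- by apply: etrans (@is_trig_block_mx _ 1 n 1 n _ _ _ _ erefl) _; rewrite eqxx scalar_mx_is_trig tT.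
- move=> i; case: (@split_ordP 1 n i) => j ->.
    by rewrite [T1 _ _]block_mxEul [S1 _ _]block_mxEul !mxE !ord1 eqxx !mulr1n invr_gt0 s0 invrK.
  by rewrite [T1 _ _]block_mxEdr [S1 _ _]block_mxEdr; exact: pT.
- have -> : S1 *m T1 = block_mx (s%:M *m (s^-1)%:M) 0
      (s^-1 *: b *m (s^-1)%:M + S *m (- a^-1 *: (T *m b))) (S *m T).
    by rewrite /S1 /T1 mulmx_block !mulmx0 !mul0mx !addr0 !add0r.
  rewrite ST -scalar_mxM divff ?gt_eqF// -scalemxAr mulmxA ST mul1mx.
  rewrite mul_mx_scalar scalerA -invfM s2 -scalerDl subrr scale0r.
  by rewrite -scalar_mx_block.
- have -> : S1^T = block_mx s%:M (s^-1 *: b^T) 0 S^T.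
    by rewrite /S1 tr_block_mx tr_scalar_mx trmx0 linearZ.
  have -> : S1 *m block_mx s%:M (s^-1 *: b^T) 0 S^T =
    block_mx (s%:M *m s%:M) (s%:M *m (s^-1 *: b^T)) (s^-1 *: b *m s%:M)
      (s^-1 *: b *m (s^-1 *: b^T) + S *m S^T).
    by rewrite /S1 mulmx_block !mulmx0 !mul0mx !addr0.
  rewrite -scalar_mxM s2.
  rewrite !mul_scalar_mx !mul_mx_scalar !scalerA divff ?gt_eqF// !scale1r.
  rewrite -scalemxAl -scalemxAr scalerA -invfM s2 -NE addrC subrK; exact: N1E.
Qed.

(** * Derivative of a determinant *)

Lemma is_derive_bigsum (R : realType) (I : Type) (r : seq I) (P : pred I)
    (F : I -> R -> R) (dF : I -> R) (t : R) :
  (forall i, is_derive t 1 (F i) (dF i)) ->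
  is_derive t 1 (fun s => \sum_(i <- r | P i) F i s) (\sum_(i <- r | P i) dF i).
Proof.
move=> h; elim: r => [|i r IH].
  rewrite big_nil (_ : (fun _ => _) = cst 0); first exact: is_derive_cst.
  by apply/funext => s; rewrite big_nil.
rewrite big_cons; case: ifPn => Pi.
  rewrite (_ : (fun _ => _) = F i + (fun s => \sum_(i <- r | P i) F i s)).
    exact: is_deriveD.
  by apply/funext => s; rewrite big_cons Pi.
by under eq_fun do rewrite big_cons (negbTE Pi).
Qed.

Lemma is_derive_bigprod (R : realType) (I : eqType) (r : seq I)
    (F : I -> R -> R) (dF : I -> R) (t : R) : uniq r ->
  (forall i, is_derive t 1 (F i) (dF i)) ->
  is_derive t 1 (fun s => \prod_(i <- r) F i s)
    (\sum_(i <- r) dF i * \prod_(j <- r | i != j) F j t).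
Proof.
move=> + h; elim: r => [|i r IH].
  move=> _; rewrite big_nil (_ : (fun _ => _) = cst 1); first exact: is_derive_cst.
  by apply/funext => s; rewrite big_nil.
move=> /= /andP[ir ur].
rewrite (_ : (fun _ => _) = F i * (fun s => \prod_(i <- r) F i s)); last first.
  by apply/funext => s; rewrite big_cons.
apply: (@is_derive_eq _ _ _ _ _ _ _ _ (is_deriveM (h i) (IH ur))).
rewrite big_cons !scaler_sumr big_cons eqxx/= /GRing.scale/= addrC mulrC; congr (_ * _ + _).
  rewrite [LHS]big_seq [RHS]big_seq_cond; apply: eq_big => // j; rewrite ?andbT.
  case jr: (j \in r) => //=; apply/esym; apply: contraNneq ir => ->; exact: jr.
rewrite [LHS]big_seq [RHS]big_seq; apply: eq_bigr => j jr.
rewrite big_cons ifT; first by rewrite mulrCA.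
by apply: contraNneq ir => <-.
Qed.

(** Jacobi's formula. *)
Lemma is_derive_det (R : realType) n (N : R -> 'M[R]_n) (N' : 'M[R]_n) (t : R) :
  (forall i j, is_derive t 1 (fun s => N s i j) (N' i j)) ->
  is_derive t 1 (fun s => \det (N s)) (\tr (N' *m \adj (N t))).
Proof.
move=> h.
pose c (s : 'S_n) : R := (-1) ^+ s.
have E (s : 'S_n) : is_derive t 1 (fun u => c s * \prod_i N u i (s i))
    (c s * \sum_i N' i (s i) * \prod_(j | i != j) N t j (s j)).
  exact: (@is_deriveZ _ _ _ _ (c s) _ _ _
    (@is_derive_bigprod _ _ _ _ _ _ (index_enum_uniq _) (fun i => h i (s i)))).
have := @is_derive_bigsum R _ (index_enum _) xpredT _ _ _ E.
move=> /is_derive_eq; apply.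
rewrite /mxtrace; under [RHS]eq_bigr do rewrite mxE.
under [RHS]eq_bigr => i _ do under eq_bigr => j _ do rewrite mxE expand_cofactor mulr_sumr.
under [LHS]eq_bigr do rewrite mulr_sumr.
rewrite exchange_big/=; apply: eq_bigr => i _.
rewrite (exchange_big_dep xpredT)//= ; apply: eq_bigr => s _.
rewrite [RHS](big_pred1 (s i)) => [|j]; first by rewrite mulrCA.
by rewrite /= eq_sym.
Qed.

Lemma continuous_det (R : realType) n (N : R -> 'M[R]_n) :
  (forall i j, continuous (fun s => N s i j)) -> continuous (fun s => \det (N s)).
Proof.
move=> h; apply: continuous_big => [|s _ x]; first exact: add_continuous.
apply: cvgM; first exact: cvg_cst.
by move: x; apply: continuous_big => [|i _]; [exact: mul_continuous|exact: h].
Qed.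

(** * Lebesgue measure under triangular affine maps *)

Section affine1.
Local Open Scope ereal_scope.
Variables (R : realType) (a b : R).
Hypothesis a0 : (0 < a)%R.

Let phi (x : measurableTypeR R) : measurableTypeR R := (a * x + b)%R.

Let mphi : measurable_fun setT phi.
Proof. by apply: measurable_funD => //; apply: measurable_funM. Qed.

Lemma ge0_integral_affine (F : R -> \bar R) :
  measurable_fun setT F -> (forall x, 0 <= F x) ->
  \int[lebesgue_measure]_x F (a * x + b)%R =
  (a^-1)%:E * \int[lebesgue_measure]_x F x.
Proof.
move=> mF F0.
have ia0 : (0 <= a)%R by exact: ltW.
(* The image of Lebesgue measure under [phi], with its measurability proof. *)
pose p := (measure_function_pushforward__canonical__measure_function_Measure (@lebesgue_measure R) mphi).
pose m : {measure set (measurableTypeR R) -> \bar R} := mscale (NngNum ia0) p.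
have mE A : measurable A -> lebesgue_measure A = m A.
  apply: lebesgue_measure_unique => _ [[c d]] _ <-.
  rewrite /m /= /mscale /pushforward/=.
  have -> : pushforward lebesgue_measure phi `]c, d] =
      lebesgue_measure (`](c - b) / a, (d - b) / a]%classic)%R.
    congr (lebesgue_measure _); apply/seteqP; split => x/=;
      by rewrite !in_itv/= ltr_pdivrMr// ler_pdivlMr// /phi mulrC ltrBlDr lerBrDr.
  rewrite !lebesgue_measure_itv/= !lte_fin ltr_pM2r ?invr_gt0// ltrD2r.
  case: ifPn; rewrite ?mule0// => _.
  by rewrite -EFinB -EFinM; congr EFin; field; rewrite gt_eqF.
rewrite [X in _ * X](eq_measure_integral m); last by move=> A mA _; exact: mE.
rewrite /m ge0_integral_mscale//= muleA -EFinM mulVf ?gt_eqF// mul1e.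
by rewrite ge0_integral_pushforward.
Qed.
End affine1.

(** The affine map [x |-> T x + b] of [R^n]. *)
Definition aff (R : realType) n (T : 'M[R]_n) (b : 'cV[R]_n) (x : n.-tuple R) :
  n.-tuple R := [tuple \sum_j T i j * tnth x j + b i 0 | i < n].

Lemma measurable_aff (R : realType) n (T : 'M[R]_n) b : measurable_fun setT (aff T b).
Proof.
apply/measurable_fun_tnthP => i; rewrite (_ : _ \o _ = fun x => \sum_j T i j * tnth x j + b i 0).
  apply: measurable_funD => //; apply: measurable_sum => j.
  by apply: measurable_funM => //; exact: measurable_tnth.
by apply/funext => x /=; rewrite tnth_mktuple.
Qed.

(** Splitting off the first coordinate: the map acts on the last [n] coordinates
    by an affine map whose translation depends on the first one. *)
Lemma aff_tcons (R : realType) n (T : 'M[R]_n.+1) b x (y : n.-tuple R) :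
  aff T b (tcons (x, y)) = tcons (T 0 0 * x + \sum_j T 0 (lift ord0 j) * tnth y j + b 0 0,
     aff (\matrix_(i, j) T (lift ord0 i) (lift ord0 j))
       (\col_i (b (lift ord0 i) 0 + T (lift ord0 i) 0 * x)) y).
Proof.
apply: eq_from_tnth => i; rewrite tnth_mktuple big_ord_recl.
have E j : tnth (tcons (x, y)) (lift ord0 j) = tnth y j by rewrite /tcons tnthS.
under eq_bigr do rewrite E.
have [j ->|->] := unliftP ord0 i; last by rewrite !tnth0.
rewrite tnth0 [RHS]tnthS/= tnth_mktuple !mxE.
under [in RHS]eq_bigr do rewrite mxE.
by rewrite -addrA [LHS]addrC -addrA.
Qed.

(** For a lower triangular [T], the first coordinate of the image depends on [x_0]
    only, so Fubini's theorem reduces the claim to dimensions [1] and [n]. *)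
Lemma lebesgue_n_aff (R : realType) n (T : 'M[R]_n) b (A : set (n.-tuple R)) :
  is_trig_mx T -> (forall i, 0 < T i i) -> measurable A ->
  lebesgue_n (aff T b @^-1` A) = ((\prod_i T i i)^-1%:E * lebesgue_n A)%E.
Proof.
elim: n T b A => [|n IH] T b A trT pT mA.
  rewrite big_ord0 invr1 mul1e; congr (lebesgue_n _).
  by apply/seteqP; split => x /=; rewrite !(tuple0 (aff _ _ _)) (tuple0 x).
have mtA : measurable (@tcons R n @^-1` A).
  by rewrite -[X in measurable X]setTI; exact: measurable_tcons.
rewrite /= /pushforward /product_measure1.
pose T' := \matrix_(i, j) T (lift ord0 i) (lift ord0 j).
pose c := (\prod_i T' i i)^-1.
pose F x := lebesgue_n (xsection (@tcons R n @^-1` A) x).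
have T0 j : T 0 (lift ord0 j) = 0 by move/is_trig_mxP : trT; apply.
have T00 : 0 < T 0 0 by exact: pT.
have trT' : is_trig_mx T'.
  by apply/is_trig_mxP => i j ij; rewrite mxE; move/is_trig_mxP : trT; apply.
have pT' i : 0 < T' i i by rewrite mxE; exact: pT.
have mF : measurable_fun setT F by exact: measurable_fun_xsection.
transitivity (\int[lebesgue_measure]_x (c%:E * F (T 0 0 * x + b 0 0)%R))%E.
  apply: eq_integral => x _ /=; rewrite /F -(IH T' (\col_i (b (lift ord0 i) 0 + T (lift ord0 i) 0 * x)))//; last exact: measurable_xsection.
  congr (lebesgue_n _); apply/seteqP; split=> y;
    by rewrite /xsection/= !inE/= aff_tcons big1 ?addr0// => j _; rewrite T0 mul0r.
rewrite ge0_integralZl//=.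
- rewrite ge0_integral_affine// muleA -EFinM; congr (_%:E * _)%E.
  rewrite big_ord_recl invfM mulrC; congr (_ * _^-1).
  by apply: eq_bigr => i _; rewrite mxE.
- by apply: (measurableT_comp mF); apply: measurable_funD => //; exact: measurable_funM.
- by rewrite lee_fin invr_ge0 prodr_ge0// => i _; exact: ltW.
Qed.

(** * Measures with a density *)

Section density.
Local Open Scope ereal_scope.
Context d (T : measurableType d) (R : realType).

Section integral.
Variables (la : {sigma_finite_measure set T -> \bar R})
  (nu : {finite_measure set T -> \bar R}) (f : T -> R).
Hypotheses (mf : measurable_fun setT f) (f0 : forall x, (0 <= f x)%R)
  (nuE : forall A, measurable A -> nu A = \int[la]_(x in A) (f x)%:E).

Let mEf : measurable_fun setT (EFin \o f).
Proof. exact/measurable_EFinP. Qed.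

Let intf : la.-integrable setT (EFin \o f).
Proof.
apply/integrableP; split => //.
under eq_integral => x _ do rewrite /= ger0_norm//.
by rewrite -nuE// ltey_eq fin_num_measure.
Qed.

Let dom : nu `<< la.
Proof.
apply/null_content_dominatesP => A mA A0; rewrite nuE//.
by apply: null_set_integral => //; exact: measurable_funTS.
Qed.

(** Both [f] and the Radon-Nikodym derivative of [nu] are densities of [nu], so
    they agree almost everywhere. *)
Lemma ge0_integral_density (g : T -> \bar R) :
  measurable_fun setT g -> (forall x, 0 <= g x) -> forall E, measurable E ->
  \int[nu]_(x in E) g x = \int[la]_(x in E) (g x * (f x)%:E).
Proof.
move=> mg g0 E mE.
have mgE := measurable_funTS (D := E) mg.
rewrite -(Radon_Nikodym_SigmaFinite.change_of_variables dom)//.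
have irn := Radon_Nikodym_SigmaFinite.f_integrable dom.
have ae : ae_eq la setT (Radon_Nikodym_SigmaFinite.f nu la) (EFin \o f).
  apply: integral_ae_eq => // A _ mA.
  by rewrite -Radon_Nikodym_SigmaFinite.f_integral// nuE.
apply: ae_eq_integral => //.
- apply: emeasurable_funM => //; apply: measurable_funTS; exact: measurable_int irn.
- by apply: emeasurable_funM => //; exact: measurable_funTS.
- by apply: filterS ae => x /= h _; rewrite h.
Qed.

(** No integrability is needed: both sides are, by definition, differences of the
    integrals of the positive and negative parts. *)
Lemma integral_density (g : T -> R) : measurable_fun setT g ->
  \int[nu]_x (g x)%:E = \int[la]_x (g x * f x)%:E.
Proof.
move=> mg.
have mp : measurable_fun setT (fun x => (funrpos g x)%:E).
  by apply/measurable_EFinP; exact: measurable_funrpos.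
have mn : measurable_fun setT (fun x => (funrneg g x)%:E).
  by apply/measurable_EFinP; exact: measurable_funrneg.
rewrite [LHS]integralE [RHS]integralE; congr (_ - _).
  transitivity (\int[nu]_x (funrpos g x)%:E).
    by apply: eq_integral => x _; rewrite funeposE /funrpos EFin_max.
  rewrite ge0_integral_density//; last by move=> x; rewrite lee_fin funrpos_ge0.
  apply: eq_integral => x _; rewrite funeposE /funrpos -EFinM -EFin_max.
  by rewrite maxr_pMl// mul0r.
transitivity (\int[nu]_x (funrneg g x)%:E).
  by apply: eq_integral => x _; rewrite funenegE /funrneg EFin_max.
rewrite ge0_integral_density//; last by move=> x; rewrite lee_fin funrneg_ge0.
apply: eq_integral => x _; rewrite funenegE /funrneg -EFinM -EFinN -EFin_max.
by rewrite maxr_pMl// mul0r mulNr.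
Qed.
End integral.

Lemma density_probability (la : {measure set T -> \bar R}) (f : T -> R) :
  measurable_fun setT f -> (forall x, (0 <= f x)%R) ->
  \int[la]_x (f x)%:E = 1 ->
  exists P : probability T R, forall A, P A = \int[la]_(x in A) (f x)%:E.
Proof.
move=> mf f0 f1.
pose m (A : set T) := \int[la]_(x in A) (f x)%:E.
have m0 : m set0 = 0 by rewrite /m integral_set0.
have m_ge0 A : 0 <= m A by apply: integral_ge0 => x _; rewrite lee_fin.
have ms : semi_sigma_additive m.
  move=> A mA tA mUA; rewrite /m ge0_integral_bigcup//.
  - apply: is_cvg_ereal_nneg_natsum_cond => n _ _; exact: m_ge0.
  - by apply/measurable_funTS; exact/measurable_EFinP.
  - by move=> x _; rewrite lee_fin.
pose M1 := isMeasure.Build _ _ _ m m0 m_ge0 ms.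
pose M : {measure set T -> \bar R} := HB.pack m M1.
pose P1 := Measure_isProbability.Build _ _ _ M f1.
pose P : probability T R := HB.pack m M1 P1.
by exists P.
Qed.
Lemma integral_distributionE d' (T' : measurableType d') (P : probability T R) (X : {mfun T >-> T'}) (g : T' -> \bar R) :
  measurable_fun setT g -> \int[distribution P X]_y g y = \int[P]_x g (X x).
Proof.
move=> mg; rewrite [LHS]integralE [RHS]integralE; congr (_ - _).
  rewrite ge0_integral_distribution//; last exact: measurable_funepos.
  by rewrite -funepos_comp.
rewrite ge0_integral_distribution//; last exact: measurable_funeneg.
by rewrite -funeneg_comp.
Qed.

End density.

(** * Log-concave functions *)

(** The squared Euclidean norm. *)
Definition sqnorm (R : realType) n (x : n.-tuple R) : R := \sum_(i < n) tnth x i ^+ 2.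

Lemma measurable_sqnorm (R : realType) n : measurable_fun setT (@sqnorm R n).
Proof.
by apply: measurable_sum => i; apply: measurable_funX; exact: measurable_tnth.
Qed.

Lemma enormE (R : realType) n (x : n.-tuple R) : (enorm x ^+ 2 = sqnorm x)%R.
Proof. by rewrite sqr_sqrtr// sumr_ge0// => i _; exact: sqr_ge0. Qed.

Section log_concave.
Variables (R : realType) (n : nat).
Implicit Types (f : n.-tuple R -> R) (x y : n.-tuple R).

(** Log-concavity of a nonnegative function without extended logarithms: only
    points where it is positive matter. *)
Lemma log_concaveP f : (forall x, 0 <= f x) ->
  log_concave f <-> forall t x y, 0 < t < 1 -> 0 < f x -> 0 < f y ->
    0 < f (tconv t x y) /\
    t * ln (f x) + (1 - t) * ln (f y) <= ln (f (tconv t x y)).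
Proof.
move=> f0; split=> H t x y.
  move=> /andP[t0 t1] fx fy.
  have := H t x y; rewrite (ltW t0) (ltW t1) => /(_ isT).
  rewrite (lne_EFin fx) (lne_EFin fy); have [fz|fz] := ltP 0 (f (tconv t x y)).
    by rewrite lne_EFin// lee_fin.
  by rewrite le0_lneNy ?lee_fin// leeNy_eq.
move=> /andP[t0 t1].
have [t00|tn0] := eqVneq t 0.
  rewrite t00 mul0e add0e subr0 mul1e (_ : tconv _ _ _ = y)//.
  by apply: eq_from_tnth => i; rewrite tnth_mktuple mul0r add0r subr0 mul1r.
have [t11|tn1] := eqVneq t 1.
  rewrite t11 subrr mul0e adde0 mul1e (_ : tconv _ _ _ = x)//.
  by apply: eq_from_tnth => i; rewrite tnth_mktuple subrr mul0r addr0 mul1r.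
have tp : 0 < t by rewrite lt_neqAle eq_sym tn0.
have tq : 0 < 1 - t by rewrite subr_gt0 lt_neqAle tn1.
have [fx|fx] := ltP 0 (f x); last first.
  by rewrite (@le0_lneNy _ (f x)%:E) ?lee_fin// gt0_muleNy ?lte_fin// addNye leNye.
have [fy|fy] := ltP 0 (f y); last first.
  by rewrite (@le0_lneNy _ (f y)%:E) ?lee_fin// gt0_muleNy ?lte_fin// addeNy leNye.
have [|fz Hz] := H t x y _ fx fy; first by rewrite tp -subr_gt0.
by rewrite !lne_EFin// lee_fin.
Qed.

Lemma log_concave_tilt f c : (forall x, 0 <= f x) -> 0 <= c ->
  log_concave f -> log_concave (fun x => expR (- (c * sqnorm x)) * f x).
Proof.
move=> f0 c0 /(log_concaveP f0) H.
apply/log_concaveP => [x|t x y t01]; first by rewrite mulr_ge0// expR_ge0.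
rewrite !(pmulr_rgt0 _ (expR_gt0 _)) => fx fy.
have [fz Hz] := H t x y t01 fx fy; split=> //.
rewrite !lnM ?posrE ?expR_gt0// !expRK.
(* Convexity of the squared norm. *)
suff : sqnorm (tconv t x y) <= t * sqnorm x + (1 - t) * sqnorm y by nra.
rewrite /sqnorm !mulr_sumr -big_split/=; apply: ler_sum => i _.
rewrite tnth_mktuple; case/andP: t01 => t0 t1.
have t2 : 0 <= t * (1 - t) by rewrite mulr_ge0// ?subr_ge0 ltW.
have := mulr_ge0 t2 (sqr_ge0 (tnth x i - tnth y i)).
move: (tnth x i) (tnth y i) => a b.
rewrite -subr_ge0 (_ : t * (1 - t) * _ = t * a ^+ 2 + (1 - t) * b ^+ 2 - (t * a + (1 - t) * b) ^+ 2)//.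
ring.
Qed.

Lemma log_concave_scale f k : (forall x, 0 <= f x) -> 0 < k ->
  log_concave f -> log_concave (fun x => k * f x).
Proof.
move=> f0 k0 /(log_concaveP f0) H.
apply/log_concaveP => [x|t x y t01]; first by rewrite mulr_ge0// ltW.
rewrite !(pmulr_rgt0 _ k0) => fx fy.
have [fz Hz] := H t x y t01 fx fy; split=> //.
by rewrite !lnM ?posrE//; lra.
Qed.

Lemma aff_tconv (T : 'M[R]_n) b t x y :
  aff T b (tconv t x y) = tconv t (aff T b x) (aff T b y).
Proof.
apply: eq_from_tnth => i; rewrite !tnth_mktuple.
under eq_bigr do rewrite tnth_mktuple mulrDr mulrCA [X in _ + X]mulrCA.
rewrite big_split/= -!mulr_sumr; ring.
Qed.

Lemma log_concave_aff f (T : 'M[R]_n) b :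
  log_concave f -> log_concave (f \o aff T b).
Proof. by move=> H t x y t01 /=; rewrite aff_tconv; exact: H. Qed.
End log_concave.

(** * The thin-shell bound in an affine position *)

Section tilted_affine_law.
Local Open Scope ereal_scope.

Variables (R : realType) (n : nat) (mu : probability (n.-tuple R) R).
Variables (c Z : R) (T : 'M[R]_n) (b : 'cV[R]_n).
Hypotheses (c0 : (0 <= c)%R) (Z0 : (0 < Z)%R).
Let rho (x : n.-tuple R) : R := (expR (- (c * sqnorm x)) / Z)%R.
Hypotheses (trT : is_trig_mx T) (pT : forall i, (0 < T i i)%R).

Let rho_ge0 x : (0 <= rho x)%R.
Proof. by rewrite divr_ge0 ?expR_ge0// ltW. Qed.

Let mrho : measurable_fun setT rho.
Proof.
apply: measurable_funM => //; apply: measurableT_comp => //.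
by apply: measurable_funN => //; apply: measurable_funM => //; exact: measurable_sqnorm.
Qed.

(** The image of the tilted probability [rho mu] under the triangular affine map
    is log-concave. *)
Lemma tilted_affine_law : log_concave_measure mu -> \int[mu]_x (rho x)%:E = 1 ->
  exists2 nu : probability (n.-tuple R) R, log_concave_measure nu &
  forall g : n.-tuple R -> R, measurable_fun setT g ->
    \int[nu]_y (g y)%:E = \int[mu]_x (g (aff T b x) * rho x)%:E.
Proof.
move=> [f [mf f0 lcf muE]] rho1.
have [P PE] := density_probability mrho rho_ge0 rho1.
pose ph_mixin := isMeasurableFun.Build _ _ _ _ _ (measurable_aff T b).
pose ph : {mfun n.-tuple R >-> n.-tuple R} := HB.pack (aff T b) ph_mixin.
exists (distribution P ph); last first.
  move=> g mg; rewrite integral_distributionE; last exact/measurable_EFinP.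
  rewrite (integral_density (la := mu) (nu := P) mrho rho_ge0)//.
    by move=> A mA; rewrite -PE.
  by apply: measurableT_comp mg _; exact: measurable_aff.
have dT : (0 < \prod_i T i i)%R by apply: prodr_gt0 => i _; exact: pT.
have uT : T \in unitmx by rewrite unitmxE det_trig// unitfE gt_eqF.
pose S := invmx T; pose b' : 'cV[R]_n := (- (S *m b))%R.
have psK : cancel (aff T b) (aff S b').
  move=> x; apply: eq_from_tnth => i; rewrite tnth_mktuple.
  pose X : 'cV[R]_n := \col_j tnth x j.
  have : ((S *m (T *m X + b) + b') i 0 = X i 0)%R.
    by rewrite mulmxDr mulmxA mulVmx// mul1mx /b' addrK.
  rewrite [X i 0%R]mxE => <-; rewrite [RHS]mxE; congr (_ + _)%R; rewrite [RHS]mxE.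
  apply: eq_bigr => j _; rewrite tnth_mktuple !mxE; congr (_ * (_ + _))%R.
  by apply: eq_bigr => k _; rewrite !mxE.
(* The density of the image is [k * G], where [S] and [b'] define the inverse map. *)
pose G y : R := ((expR (- (c * sqnorm (aff S b' y))) * f (aff S b' y)))%R.
pose k := (Z^-1 * (\prod_i T i i)^-1)%R.
have k0 : (0 < k)%R by rewrite mulr_gt0// invr_gt0.
have mexp : measurable_fun setT (fun x : n.-tuple R => expR (- (c * sqnorm x)))%R.
  apply: measurableT_comp => //.
  by apply: measurable_funN => //; apply: measurable_funM => //; exact: measurable_sqnorm.
have mG : measurable_fun setT G.
  apply: (measurableT_comp (f := fun x => expR (- (c * sqnorm x)) * f x)%R).
    exact: measurable_funM.
  exact: measurable_aff.
have G0 x : (0 <= G x)%R by rewrite mulr_ge0 ?expR_ge0.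
exists (fun y => k * G y)%R; split.
- exact: measurable_funM.
- by move=> y; rewrite mulr_ge0// ltW.
- apply: log_concave_scale => //.
  apply: (@log_concave_aff _ _ (fun x => expR (- (c * sqnorm x)) * f x)%R).
  exact: log_concave_tilt.
move=> A mA.
have mphA : measurable (aff T b @^-1` A).
  by rewrite -[X in measurable X]setTI; exact: measurable_aff.
transitivity (P (aff T b @^-1` A)); first by [].
rewrite PE.
rewrite (ge0_integral_density (la := @lebesgue_n R n) (nu := mu) mf)//; last exact/measurable_EFinP.
pose kT := (\prod_i T i i)^-1%R.
have kT0 : (0 <= kT)%R by rewrite invr_ge0 ltW.
transitivity (\int[mscale (NngNum kT0) lebesgue_n]_(x in A) (Z^-1 * G x)%:E).
  transitivity (\int[pushforward lebesgue_n (aff T b)]_(x in A) (Z^-1 * G x)%:E).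
    rewrite ge0_integral_pushforward//=.
    - by apply: eq_integral => x _; rewrite /= /G psK -EFinM /rho; congr EFin; ring.
    - exact: measurable_aff.
    - by apply/measurable_EFinP; apply: measurable_funTS; exact: measurable_funM.
    - by move=> x _; rewrite lee_fin mulr_ge0// invr_ge0 ltW.
  apply: eq_measure_integral => [|mph B mB _]; first exact: measurable_aff.
  exact: lebesgue_n_aff.
rewrite ge0_integral_mscale//.
- rewrite -ge0_integralZl//=.
  + by apply: eq_integral => x _; rewrite -EFinM /k; congr EFin; rewrite /kT; ring.
  + by apply/measurable_EFinP; apply: measurable_funTS; exact: measurable_funM.
  + by move=> x _; rewrite lee_fin mulr_ge0// invr_ge0 ltW.
- by apply/measurable_EFinP; apply: measurable_funTS; exact: measurable_funM.
- by move=> x _; rewrite lee_fin mulr_ge0// invr_ge0 ltW.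
Qed.
End tilted_affine_law.

Section thin_shell.
Local Open Scope ereal_scope.
Variables (R : realType) (n : nat) (mu : probability (n.-tuple R) R).

(** If the affine image [Y] of the tilted probability [rho mu] is isotropic, the
    thin-shell bound controls the fluctuations of its squared norm. *)
Lemma thin_shell_affine (c Z D : R) (T : 'M[R]_n) (b : 'cV[R]_n) :
  (0 <= c)%R -> (0 < Z)%R -> is_trig_mx T -> (forall i, (0 < T i i)%R) ->
  (0 < n)%N -> log_concave_measure mu -> thin_shell2 R n <= (2 * D)%:E ->
  let rho x := (expR (- (c * sqnorm x)) / Z)%R in
  let Y := aff T b in
  \int[mu]_x (rho x)%:E = 1 ->
  (forall i, \int[mu]_x (tnth (Y x) i * rho x)%:E = 0) ->
  (forall i j, \int[mu]_x (tnth (Y x) i * tnth (Y x) j * rho x)%:E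
     = ((i == j)%:R)%:E) ->
  \int[mu]_x ((sqnorm (Y x) - n%:R) ^+ 2 * rho x)%:E <= (2 * D * n%:R)%:E.
Proof.
move=> c0 Z0 trT pT n0 lmu ts rho Y rho1 Y0 Y1.
have [nu lnu nuE] := tilted_affine_law b c0 Z0 trT pT lmu rho1.
have mt i : measurable_fun setT (fun y : n.-tuple R => tnth y i) by exact: measurable_tnth.
have E0 i : 'E_nu[fun y => tnth y i] = 0.
  by rewrite unlock nuE.
have E1 i j : \int[nu]_y (tnth y i * tnth y j)%:E = ((i == j)%:R)%:E.
  by rewrite nuE ?Y1//; exact: measurable_funM.
have iso : isotropic nu.
  split=> // i j; rewrite unlock/= !E0/= unlock -E1.
  by apply: eq_integral => y _; rewrite mulrfctE /= !subr0.
have Er : 'E_nu[fun y => (enorm y ^+ 2)%R] = n%:R%:E.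
  rewrite unlock; under eq_integral do rewrite enormE /sqnorm -sumEFin.
  rewrite ge0_integral_sum//=.
  - under eq_bigr do under eq_integral do rewrite expr2.
    under eq_bigr do rewrite E1 eqxx.
    by rewrite sumEFin sumr_const card_ord.
  - by move=> i; apply/measurable_EFinP; apply: measurable_funX; exact: mt.
  - by move=> i y _; rewrite lee_fin sqr_ge0.
have : (n%:R^-1)%:E * variance nu (fun x => (enorm x ^+ 2)%R) <= (2 * D)%:E.
  apply: le_trans ts; apply: ereal_sup_ubound => /=; exists nu => //.
have -> : variance nu (fun x => (enorm x ^+ 2)%R) =
    \int[mu]_x ((sqnorm (Y x) - n%:R) ^+ 2 * rho x)%:E.
  rewrite /variance covariance.unlock Er/= expectation.unlock.
  rewrite -(nuE (fun y => (sqnorm y - n%:R) ^+ 2)%R).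
    by apply: eq_integral => y _; rewrite mulrfctE /= enormE expr2.
  by apply: measurable_funX; apply: measurable_funB => //; exact: measurable_sqnorm.
rewrite muleC => H; by rewrite [leRHS]EFinM -lee_pdivrMr ?ltr0n.
Qed.
End thin_shell.

(** * Gaussian-weighted integrals *)

Section gaussian_weight.
Variables (R : realType) (n : nat) (mu : probability (n.-tuple R) R).
Implicit Types (g : n.-tuple R -> R) (t : R).

(** The weight [exp (- t |x|^2 / 2)]. *)
Definition gauss_weight t (x : n.-tuple R) : R := expR (- (t / 2 * sqnorm x)).

(** The integral of [g] against the weight; it is not normalized. *)
Definition wint t g : R := \int[mu]_x (g x * gauss_weight t x).

(** Growth slower than every [exp (s |x|^2)], [s > 0].  This class is closed under
    sums and products, contains the polynomials, and its members are integrable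
    against the weight for [t > 0]. *)
Definition subexp g := measurable_fun setT g /\
  forall s, 0 < s -> exists C, forall x, `|g x| <= C * expR (s * sqnorm x).

(** At most quadratic growth; it gives integrability down to [t = 0] as soon as
    [|x|^2] is integrable. *)
Definition quad g := measurable_fun setT g /\
  exists C, forall x, `|g x| <= C * (1 + sqnorm x).

Lemma sqnorm_ge0 (x : n.-tuple R) : 0 <= sqnorm x.
Proof. by apply: sumr_ge0 => i _; exact: sqr_ge0. Qed.

Lemma measurable_gauss_weight t : measurable_fun setT (gauss_weight t).
Proof.
apply: measurableT_comp => //; apply: measurable_funN => //.
by apply: measurable_funM => //; exact: measurable_sqnorm.
Qed.

Lemma gauss_weight_le1 t x : 0 <= t -> gauss_weight t x <= 1.
Proof.
move=> t0; rewrite -[leRHS]expR0 ler_expR oppr_le0 mulr_ge0//; last exact: sqnorm_ge0.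
by rewrite divr_ge0.
Qed.

Lemma quad_subexp g : quad g -> subexp g.
Proof.
move=> [mg [C gC]]; split=> // s s0.
exists (`|C| * (1 + s^-1)) => x; apply: le_trans (gC x) _.
have r0 := sqnorm_ge0 x.
apply: (@le_trans _ _ (`|C| * (1 + sqnorm x))).
  by rewrite ler_wpM2r ?ler_norm// addr_ge0.
rewrite -mulrA ler_wpM2l// mulrDl mul1r lerD//.
  by rewrite -[leLHS]expR0 ler_expR mulr_ge0// ltW.
rewrite ler_pdivlMl//; apply: le_trans (expR_ge1Dx _); by rewrite lerDr.
Qed.

Lemma subexpD g h : subexp g -> subexp h -> subexp (fun x => g x + h x).
Proof.
move=> [mg eg] [mh eh]; split; first exact: measurable_funD.
move=> s s0; have [C gC] := eg s s0; have [C' hC] := eh s s0.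
exists (C + C') => x; rewrite mulrDl; apply: le_trans (ler_normD _ _) _.
by rewrite lerD.
Qed.

Lemma subexpM g h : subexp g -> subexp h -> subexp (fun x => g x * h x).
Proof.
move=> [mg eg] [mh eh]; split; first exact: measurable_funM.
move=> s s0; have s20 : 0 < s / 2 by rewrite divr_gt0.
have [C gC] := eg _ s20; have [C' hC] := eh _ s20.
exists (C * C') => x; rewrite normrM.
rewrite (_ : s * _ = s / 2 * sqnorm x + s / 2 * sqnorm x); last by field.
by rewrite expRD mulrACA ler_pM.
Qed.

Lemma quad_cst c : quad (fun _ => c).
Proof.
split; first exact: measurable_cst.
exists `|c| => x; rewrite ler_peMr// lerDl; exact: sqnorm_ge0.
Qed.

Lemma subexp_cst c : subexp (fun _ => c).
Proof. exact/quad_subexp/quad_cst. Qed.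

Lemma quad_sqnorm : quad (@sqnorm R n).
Proof.
split; first exact: measurable_sqnorm.
by exists 1 => x; rewrite mul1r ger0_norm ?sqnorm_ge0// lerDr.
Qed.

Lemma subexp_sum (I : Type) (r : seq I) (P : pred I) (F : I -> n.-tuple R -> R) :
  (forall i, subexp (F i)) -> subexp (fun x => \sum_(i <- r | P i) F i x).
Proof.
move=> h; elim: r => [|i r IH].
  by under eq_fun do rewrite big_nil; exact: subexp_cst.
under eq_fun do rewrite big_cons.
by case: (P i) => //; exact: subexpD.
Qed.

Lemma integrable_subexp t g : 0 < t -> subexp g ->
  mu.-integrable setT (fun x => (g x * gauss_weight t x)%:E).
Proof.
move=> t0 [mg eg]; have t20 : 0 < t / 2 by rewrite divr_gt0.
have [C gC] := eg _ t20.
apply: measurable_bounded_integrable => //.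
- by rewrite -ge0_fin_numE//; exact: fin_num_measure.
- by apply: measurable_funM => //; exact: measurable_gauss_weight.
exists C; split; first exact: num_real.
move=> M CM x _ /=; apply: le_trans (ltW CM).
rewrite normrM (ger0_norm (expR_ge0 _)).
apply: le_trans (ler_wpM2r (expR_ge0 _) (gC x)) _.
by rewrite -(mulrA C) /gauss_weight -expRD subrr expR0 mulr1.
Qed.

Hypothesis int_sqnorm : mu.-integrable setT (fun x => (sqnorm x)%:E).

Lemma integrable_quad_bound C : mu.-integrable setT (fun x => (C * (1 + sqnorm x))%:E).
Proof.
under eq_fun do rewrite EFinM EFinD.
apply: integrableZl => //; apply: integrableD => //.
exact: finite_measure_integrable_cst.
Qed.

Lemma integrable_quad t g : 0 <= t -> quad g ->
  mu.-integrable setT (fun x => (g x * gauss_weight t x)%:E).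
Proof.
move=> t0 [mg [C gC]].
apply: le_integrable (integrable_quad_bound C) => //.
  apply/measurable_EFinP; apply: measurable_funM => //; exact: measurable_gauss_weight.
move=> x _ /=; rewrite lee_fin normrM (ger0_norm (expR_ge0 _)).
apply: le_trans (ler_norm _); apply: le_trans (gC x).
by rewrite ler_piMr// gauss_weight_le1.
Qed.

(** For [t < 0] the integral may diverge; composing with the absolute value states
    continuity on [0 <= t], endpoint included. *)
Lemma continuous_wint g : quad g -> continuous (fun t => wint `|t| g).
Proof.
move=> qg t; have [mg [C gC]] := qg.
have mT : measurable [set: n.-tuple R] by [].
apply: (@continuity_under_integral R _ _ mu (fun t x => g x * gauss_weight `|t| x) setT mT
   (t - 1) (t + 1) _ _ (fun x => C * (1 + sqnorm x))).
- by move=> s _; exact: integrable_quad.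
- apply: aeW => x _ s _; apply: cvgM; first exact: cvg_cst.
  apply: (@continuous_comp _ _ _ (fun s : R => - (`|s| / 2 * sqnorm x)) expR); last exact: continuous_expR.
  apply: cvgN; apply: cvgM; last exact: cvg_cst.
  apply: cvgM; last exact: cvg_cst.
  exact: norm_continuous.
- exact: integrable_quad_bound.
- move=> s _; apply: aeW => x _; rewrite normrM (ger0_norm (expR_ge0 _)).
  by apply: le_trans (gC x); rewrite ler_piMr// gauss_weight_le1.
- by rewrite inE/= in_itv/=; lra.
Qed.

Lemma is_derive_wint t g : 0 < t -> subexp g ->
  is_derive t 1 (fun s => wint s g) (- (wint t (fun x => g x * sqnorm x) / 2)).
Proof.
move=> t0 sg.
have mT : measurable [set: n.-tuple R] by [].
have d (x : n.-tuple R) (s : R) : is_derive s 1 (fun s : R => g x * gauss_weight s x)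
    (- (g x * sqnorm x * gauss_weight s x / 2)).
  have L : is_derive s 1 ((- (sqnorm x / 2)) *: id) (- (sqnorm x / 2) *: 1).
    exact: is_deriveZ.
  have := @is_deriveZ _ _ _ _ (g x) _ _ _ (is_derive1_comp (is_derive_expR _) L).
  rewrite (_ : _ \*: _ = (fun s => g x * gauss_weight s x)); last first.
    apply/funext => u; rewrite /gauss_weight; congr (_ * expR _).
    by rewrite /= /GRing.scale/= /GRing.scale/=; field.
  move=> /is_derive_eq; apply.
  rewrite /gauss_weight /GRing.scale/= (_ : - (s / 2 * sqnorm x) = - (sqnorm x / 2) * s); by field.
have [mh eh] := subexpM sg (quad_subexp quad_sqnorm).
have t40 : 0 < t / 4 by rewrite divr_gt0.
have [C hC] := eh _ t40.
have Ia : `](t / 2), (t * 2)[%classic t by rewrite /= in_itv/=; lra.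
have I1 s : `](t / 2), (t * 2)[%classic s -> mu.-integrable setT (EFin \o (fun x => g x * gauss_weight s x)).
  rewrite /= in_itv/= => /andP[s1 s2]; apply: integrable_subexp => //; lra.
have I2 s x : `](t / 2), (t * 2)[%classic s -> [set: n.-tuple R] x ->
  derivable (fun s => g x * gauss_weight s x) s 1.
  by move=> _ _; have [] := d x s.
have p1 s x : partial1of2 (fun s x => g x * gauss_weight s x) s x = - (g x * sqnorm x * gauss_weight s x / 2).
  by rewrite partial1of2E; exact: (@derive_val _ _ _ _ _ _ _ (d x s)).
have I3 : mu.-integrable setT (EFin \o (fun _ : n.-tuple R => `|C|)).
  exact: finite_measure_integrable_cst.
have I4 s x : `](t / 2), (t * 2)[%classic s -> [set: n.-tuple R] x ->
    `|partial1of2 (fun s x => g x * gauss_weight s x) s x| <= `|C|.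
  rewrite /= in_itv/= => /andP[s1 s2] _; rewrite p1 normrN.
  rewrite !normrM (ger0_norm (expR_ge0 _)) -normrM.
  apply: (@le_trans _ _ (`|g x * sqnorm x| * gauss_weight s x)).
    rewrite ler_piMr ?mulr_ge0 ?expR_ge0// ger0_norm; lra.
  apply: le_trans (ler_wpM2r (expR_ge0 _) (hC x)) _.
  apply: le_trans (ler_norm _) _.
  rewrite -(mulrA C) normrM ler_piMr// ger0_norm ?mulr_ge0 ?expR_ge0//.
  rewrite -expRD -[leRHS]expR0 ler_expR; have r0 := sqnorm_ge0 x.
  rewrite -mulNr -mulrDl mulr_le0_ge0//; lra.
(* On a neighbourhood of [t] bounded away from [0], the derivative in the parameter
   is bounded by a constant, which is integrable. *)
have D := @derivable_under_integral R _ _ mu (fun s x => g x * gauss_weight s x) setT mT t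
  (t / 2) (t * 2) Ia I1 I2 (fun=> `|C|) (fun=> normr_ge0 C) I3 I4.
have E := @differentiation_under_integral R _ _ mu (fun s x => g x * gauss_weight s x) setT mT t
  (t / 2) (t * 2) Ia I1 I2 (fun=> `|C|) (fun=> normr_ge0 C) I3 I4.
apply: DeriveDef => //.
rewrite -derive1E [LHS]E.
under eq_Rintegral do rewrite p1 -mulrN mulrC.
rewrite RintegralZl//; first by rewrite mulNr mulrC.
by apply: integrable_subexp.
Qed.

(** Integrability against the weight. *)
Definition wintegrable t g := mu.-integrable setT (fun x => (g x * gauss_weight t x)%:E).

Lemma wintD t g h : wintegrable t g -> wintegrable t h ->
  wint t (fun x => g x + h x) = wint t g + wint t h.
Proof.
move=> sg sh; rewrite /wint -RintegralD//.
by apply: eq_Rintegral => x _; rewrite mulrDl.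
Qed.

Lemma wintZ t k g : wintegrable t g -> wint t (fun x => k * g x) = k * wint t g.
Proof.
move=> sg; rewrite /wint -RintegralZl//.
by apply: eq_Rintegral => x _; rewrite mulrA.
Qed.

Lemma wintegrableZ t k g : wintegrable t g -> wintegrable t (fun x => k * g x).
Proof.
move=> ig; rewrite /wintegrable; under eq_fun do rewrite -mulrA EFinM.
exact: integrableZl.
Qed.

Lemma wintegrable_sum t (I : Type) (r : seq I) (F : I -> n.-tuple R -> R) :
  (forall i, wintegrable t (F i)) -> wintegrable t (fun x => \sum_(i <- r) F i x).
Proof.
move=> h; rewrite /wintegrable; under eq_fun do rewrite mulr_suml -sumEFin.
by apply: (@integrable_sum _ _ _ mu setT measurableT I r xpredT (fun i x => (F i x * gauss_weight t x)%:E)) => i _; exact: h.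
Qed.

Lemma wint_sum t (I : Type) (r : seq I) (F : I -> n.-tuple R -> R) :
  (forall i, wintegrable t (F i)) ->
  wint t (fun x => \sum_(i <- r) F i x) = \sum_(i <- r) wint t (F i).
Proof.
move=> h; elim: r => [|i r IH].
  rewrite big_nil /wint; under eq_Rintegral do rewrite big_nil mul0r.
  by rewrite Rintegral_cst// mul0r.
rewrite big_cons -IH -wintD//; last exact: wintegrable_sum.
by apply: eq_Rintegral => x _; rewrite big_cons.
Qed.

Lemma eq_wint t g h : g =1 h -> wint t g = wint t h.
Proof. by move=> gh; apply: eq_Rintegral => x _; rewrite gh. Qed.

Lemma wint_ge0 t g : (forall x, 0 <= g x) -> 0 <= wint t g.
Proof. by move=> g0; apply: Rintegral_ge0 => x _; rewrite mulr_ge0// expR_ge0. Qed.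

Lemma EFin_wint t g : wintegrable t g ->
  ((wint t g)%:E = \int[mu]_x (g x * gauss_weight t x)%:E)%E.
Proof.
by move=> sg; rewrite /wint /Rintegral fineK//; apply: integrable_fin_num.
Qed.

Lemma gauss_weight0 x : gauss_weight 0 x = 1.
Proof. by rewrite /gauss_weight !mul0r oppr0 expR0. Qed.

(** The weight never vanishes, so a nonnegative function whose weighted integral
    is zero for one parameter has zero integral for every other one. *)
Lemma wint_eq0 t s g : (forall x, 0 <= g x) -> measurable_fun setT g ->
  wintegrable t g -> wint t g = 0 -> wint s g = 0.
Proof.
move=> g0 mg ig E0.
have mgt u : measurable_fun setT (fun x => (g x * gauss_weight u x)%:E).
  by apply/measurable_EFinP; apply: measurable_funM => //; exact: measurable_gauss_weight.
have A : ae_eq mu setT (fun x => (g x * gauss_weight t x)%:E) (cst 0%E).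
  apply/ae_eq_integral_abs => //.
  under eq_integral do rewrite gee0_abs ?lee_fin ?mulr_ge0 ?expR_ge0//.
  by rewrite -EFin_wint// E0.
rewrite /wint /Rintegral (_ : (\int[mu]_x (g x * gauss_weight s x)%:E = 0)%E)//.
rewrite -(integral0 mu setT); apply: ae_eq_integral => //.
apply: filterS A => x /= /(_ I) [] /eqP.
by rewrite mulf_eq0 (gt_eqF (expR_gt0 _)) orbF => /eqP -> _; rewrite mul0r.
Qed.

End gaussian_weight.

(** * Moment matrices *)

Section isotropic_moments.
Variables (R : realType) (n : nat) (mu : probability (n.-tuple R) R).
Hypothesis iso : isotropic mu.
Local Notation wint := (wint mu). Local Notation wintegrable := (wintegrable mu).

Let mt i : measurable_fun setT (fun x : n.-tuple R => tnth x i).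
Proof. exact: measurable_tnth. Qed.

Lemma isotropic1 i : (\int[mu]_x (tnth x i)%:E = 0)%E.
Proof. by have [+ _] := iso => /(_ i); rewrite unlock. Qed.

Lemma isotropic2 i j : (\int[mu]_x (tnth x i * tnth x j)%:E = (i == j)%:R%:E)%E.
Proof.
have [E0 /(_ i j)] := iso; rewrite covariance.unlock !E0/= expectation.unlock => <-.
by apply: eq_integral => x _; rewrite mulrfctE /= !subr0.
Qed.

Lemma integrable_sqnorm : mu.-integrable setT (fun x => (sqnorm x)%:E).
Proof.
rewrite /sqnorm; under eq_fun do rewrite -sumEFin.
apply: integrable_sum => // i _; apply/integrableP; split.
  by apply/measurable_EFinP; exact: measurable_funX.
under eq_integral do rewrite gee0_abs ?lee_fin ?sqr_ge0// expr2.
by rewrite isotropic2 ltry.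
Qed.

(** The coordinates of the vector [(1, x)] of [R^(n+1)], the constant coming first. *)
Definition aug (x : n.-tuple R) (i : 'I_n.+1) : R :=
  if unlift ord0 i is Some j then tnth x j else 1.

Lemma aug0 x : aug x ord0 = 1. Proof. by rewrite /aug unlift_none. Qed.
Lemma augS x j : aug x (lift ord0 j) = tnth x j. Proof. by rewrite /aug liftK. Qed.

Lemma measurable_aug i : measurable_fun setT (aug^~ i).
Proof.
have [j ->|->] := unliftP ord0 i.
  by under eq_fun do rewrite augS; exact: mt.
by under eq_fun do rewrite aug0; exact: measurable_cst.
Qed.

Lemma quad_aug i j : quad (fun x => aug x i * aug x j).
Proof.
split; first by apply: measurable_funM; exact: measurable_aug.
exists 1 => x; rewrite mul1r.
have B k : aug x k ^+ 2 <= 1 + sqnorm x.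
  have [l ->|->] := unliftP ord0 k; last by rewrite aug0 expr1n lerDl sqnorm_ge0.
  rewrite augS /sqnorm (bigD1 l)//= addrCA lerDl addr_ge0// sumr_ge0// => m _.
  exact: sqr_ge0.
rewrite normrM; have := B i; have := B j; have := sqr_ge0 (`|aug x i| - `|aug x j|).
by rewrite -!(real_normK (num_real (aug _ _))); nra.
Qed.

Lemma subexp_aug i : subexp (aug^~ i).
Proof.
have := quad_subexp (quad_aug i ord0).
by under eq_fun do rewrite aug0 mulr1.
Qed.

(** The matrix of the weighted integrals of [y_i y_j p(x)], where [y = (1, x)]. *)
Definition moment t (p : n.-tuple R -> R) : 'M[R]_n.+1 :=
  \matrix_(i, j) wint t (fun x => aug x i * aug x j * p x).

Lemma moment_congr t p (A B : 'M[R]_n.+1) i j :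
  (forall k l, wintegrable t (fun x => aug x k * aug x l * p x)) ->
  (A *m moment t p *m B^T) i j =
  wint t (fun x => (\sum_k A i k * aug x k) * (\sum_l B j l * aug x l) * p x).
Proof.
move=> ip.
rewrite (@eq_wint _ _ _ _ _ (fun x => \sum_k A i k * \sum_l B j l * (aug x k * aug x l * p x))).
  rewrite wint_sum; last first.
    by move=> k; apply: wintegrableZ; apply: wintegrable_sum => l; exact: wintegrableZ.
  rewrite -mulmxA mxE; apply: eq_bigr => k _; rewrite wintZ; last first.
    by apply: wintegrable_sum => l; exact: wintegrableZ.
  congr (_ * _); rewrite mxE wint_sum; last by move=> l; exact: wintegrableZ.
  by apply: eq_bigr => l _; rewrite wintZ// !mxE mulrC.
move=> x; rewrite -mulrA mulr_suml; apply: eq_bigr => k _; rewrite -mulrA; congr (_ * _).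
rewrite mulr_suml mulr_sumr; apply: eq_bigr => l _; ring.
Qed.

Let one : n.-tuple R -> R := fun=> 1.

Lemma wintegrable_moment t k l : 0 <= t -> wintegrable t (fun x => aug x k * aug x l * one x).
Proof.
move=> t0; under eq_fun do rewrite mulr1.
by apply: integrable_quad => //; [exact: integrable_sqnorm|exact: quad_aug].
Qed.

(** This is isotropy: mass [1], mean [0] and covariance the identity. *)
Lemma moment_at0 : moment 0 one = 1%:M.
Proof.
apply/matrixP => i j; rewrite !mxE.
suff : (\int[mu]_x (aug x i * aug x j)%:E = (i == j)%:R%:E)%E.
  move=> E; have := congr1 fine E => /= <-; apply: eq_Rintegral => x _.
  by rewrite /one mulr1 gauss_weight0 mulr1.
have [k ->|->] := unliftP ord0 i; have [l ->|->] := unliftP ord0 j.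
- under eq_integral do rewrite !augS.
  by rewrite isotropic2 (inj_eq (@lift_inj _ _)).
- by under eq_integral do rewrite augS aug0 mulr1; rewrite isotropic1.
- by under eq_integral do rewrite augS aug0 mul1r; rewrite isotropic1.
- under eq_integral do rewrite !aug0 mulr1.
  by rewrite integral_cst// mul1e; exact: probability_setT.
Qed.

(** A degenerate quadratic form at [t] would be degenerate at [0], where it is the
    squared Euclidean norm. *)
Lemma posdef_moment t : 0 < t -> posdef (moment t one).
Proof.
move=> t0; split.
  apply/matrixP => i j; rewrite !mxE; apply: eq_wint => x; congr (_ * _); exact: mulrC.
move=> u u0.
pose A : 'M[R]_n.+1 := \matrix_(i, j) u 0 j.
pose L x := \sum_k u 0 k * aug x k.
have E s : 0 <= s -> (u *m moment s one *m u^T) 0 0 = wint s (fun x => L x * L x).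
  move=> s0; have := @moment_congr s one A A ord0 ord0 (fun k l => wintegrable_moment k l s0).
  rewrite (eq_wint _ _ (h := fun x => L x * L x)) => [<-|x]; last first.
    by rewrite mulr1; congr (_ * _); apply: eq_bigr => k _; rewrite mxE.
  rewrite !mxE; apply: eq_bigr => k _; rewrite !mxE; congr (_ * _).
  by apply: eq_bigr => l _; rewrite !mxE.
have mL : measurable_fun setT L.
  apply: measurable_sum => k; apply: measurable_funM => //; exact: measurable_aug.
have sL : subexp L.
  by apply: subexp_sum => k; apply: subexpM; [exact: subexp_cst|exact: subexp_aug].
rewrite E ?ltW// lt_neqAle wint_ge0 ?andbT; last by move=> x; rewrite -expr2 sqr_ge0.
apply/eqP => /esym Et; move: u0; apply/negP; rewrite negbK.
have : wint 0 (fun x => L x * L x) = 0.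
  apply: (wint_eq0 _ _ _ _ Et) => [x||]; first by rewrite -expr2 sqr_ge0.
    exact: measurable_funM.
  by apply: integrable_subexp => //; exact: subexpM.
rewrite -E// moment_at0 mulmx1 mxE => /eqP.
rewrite psumr_eq0 => [/allP H|k _]; last by rewrite mxE -expr2 sqr_ge0.
apply/eqP/matrixP => i j; rewrite ord1 mxE; apply/eqP.
by have := H j (mem_index_enum _); rewrite mxE mulf_eq0 orbb.
Qed.
End isotropic_moments.

(** * The differential inequality along the tilts *)

Section key.
Variables (R : realType) (n : nat) (mu : probability (n.-tuple R) R).
Hypothesis iso : isotropic mu.
Local Notation wint := (wint mu). Local Notation wintegrable := (wintegrable mu).
Local Notation one := (fun _ : n.-tuple R => (1 : R)).
Local Notation N t := (moment mu t one).
(* The derivative of [N]; below, [Z] is the mass of the weight and [R1] the integral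
   of [|x|^2] against it. *)
Local Notation N' t := (- 2^-1 *: moment mu t (@sqnorm R n)).
Local Notation Z t := (wint t one).
Local Notation R1 t := (wint t (@sqnorm R n)).

Lemma moment_corner t : N t 0 0 = Z t.
Proof. by rewrite mxE; apply: eq_wint => x; rewrite !aug0 !mulr1. Qed.

Lemma moment_diag_sum t : 0 <= t -> \sum_(i < n) N t (lift ord0 i) (lift ord0 i) = R1 t.
Proof.
move=> t0; rewrite [RHS](eq_wint _ _ (h := fun x => \sum_(i < n) tnth x i ^+ 2))//.
rewrite wint_sum; last first.
  move=> i; have := wintegrable_moment iso (lift ord0 i) (lift ord0 i) t0.
  by under eq_fun do rewrite !augS mulr1 -expr2.
by apply: eq_bigr => i _; rewrite mxE; apply: eq_wint => x; rewrite !augS mulr1 expr2.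
Qed.

(** The data used below, read off the Cholesky factorization of the moment matrix. *)
Lemma cholesky_moment t (S T : 'M[R]_n.+1) : 0 < t ->
  is_trig_mx S -> is_trig_mx T ->
  (forall i, 0 < T i i /\ S i i = (T i i)^-1) -> S *m T = 1%:M -> N t = S *m S^T ->
  [/\ \det (N t) = \prod_i S i i ^+ 2, S 0 0 ^+ 2 = Z t,
      forall i, 0 < S i i ^+ 2 <= N t i i,
      T *m N t *m T^T = 1%:M & \adj (N t) = \det (N t) *: (T^T *m T)].
Proof.
move=> t0 tS tT pT ST NE.
have TS : T *m S = 1%:M by exact: mulmx1C.
have Nii i : N t i i = \sum_k S i k ^+ 2.
  by rewrite NE mxE; apply: eq_bigr => k _; rewrite mxE expr2.
split.
- by rewrite NE det_mulmx det_tr det_trig// -big_split.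
- rewrite -moment_corner Nii big_ord_recl big1 ?addr0// => k _.
  by have /is_trig_mxP -> := tS; rewrite ?expr0n.
- move=> i; have [pTi ->] := pT i; rewrite exprn_gt0 ?invr_gt0//=.
  rewrite Nii (bigD1 i)//= (pT i).2 lerDl sumr_ge0// => k _; exact: sqr_ge0.
- by rewrite NE mulmxA TS mul1mx -trmx_mul TS trmx1.
have TN : T^T *m T *m N t = 1%:M.
  by rewrite NE -mulmxA (mulmxA T) TS mul1mx -trmx_mul ST trmx1.
by rewrite -[LHS]mul1mx -TN -!mulmxA mul_mx_adj mulmxA mul_mx_scalar.
Qed.

Lemma det_moment_gt0 t : 0 < t -> 0 < \det (N t).
Proof.
move=> t0; have [S [T [tS tT pT ST NE]]] := cholesky (posdef_moment iso t0).
have [-> _ H _ _] := cholesky_moment t0 tS tT pT ST NE.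
by apply: prodr_gt0 => i _; case/andP: (H i).
Qed.

Lemma mass_gt0 t : 0 < t -> 0 < Z t.
Proof.
move=> t0; have [S [T [tS tT pT ST NE]]] := cholesky (posdef_moment iso t0).
have [_ <- H _ _] := cholesky_moment t0 tS tT pT ST NE.
by case/andP: (H ord0).
Qed.

Lemma second_moment_gt0 t : (0 < n)%N -> 0 < t -> 0 < R1 t.
Proof.
move=> n0 t0; have [S [T [tS tT pT ST NE]]] := cholesky (posdef_moment iso t0).
have [_ _ H _ _] := cholesky_moment t0 tS tT pT ST NE.
have H' i : 0 < N t (lift ord0 i) (lift ord0 i).
  by case/andP: (H (lift ord0 i)) => a b; exact: lt_le_trans b.
rewrite -(moment_diag_sum (ltW t0)) (bigD1 (Ordinal n0))//= ltr_wpDr// sumr_ge0// => i _.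
exact: ltW.
Qed.

Lemma ln_le_subr1 (y : R) : 0 < y -> ln y <= y - 1.
Proof.
move=> y0; have : ln (1 + (y - 1)) <= y - 1 by apply: le_ln1Dx; lra.
by rewrite addrC subrK.
Qed.

Lemma ln_prod (I : Type) (r : seq I) (F : I -> R) : (forall i, 0 < F i) ->
  ln (\prod_(i <- r) F i) = \sum_(i <- r) ln (F i).
Proof.
move=> F0; elim: r => [|i r IH]; first by rewrite !big_nil ln1.
by rewrite !big_cons lnM ?posrE ?IH// prodr_gt0.
Qed.

(** The arithmetic-geometric mean inequality for the covariance matrix, here for the
    squares of the diagonal of the Cholesky factor, which are at most the diagonal
    entries of the moment matrix. *)
Lemma ln_det_moment_le t : (0 < n)%N -> 0 < t ->
  ln (\det (N t)) - n.+1%:R * ln (Z t) <= n%:R * ln (R1 t / Z t / n%:R).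
Proof.
move=> n0 t0; have [S [T [tS tT pT ST NE]]] := cholesky (posdef_moment iso t0).
have [-> S0 H _ _] := cholesky_moment t0 tS tT pT ST NE.
have Zp := mass_gt0 t0; have Rp := second_moment_gt0 n0 t0.
have np : 0 < n%:R :> R by rewrite ltr0n.
set v := R1 t / Z t / n%:R.
have vp : 0 < v by rewrite !divr_gt0.
have Zv : 0 < Z t * v by rewrite mulr_gt0.
rewrite big_ord_recl S0 lnM ?posrE//; last first.
  by apply: prodr_gt0 => i _; case/andP: (H (lift ord0 i)).
have -> : ln (\prod_(i < n) S (lift ord0 i) (lift ord0 i) ^+ 2) =
    \sum_(i < n) ln (S (lift ord0 i) (lift ord0 i) ^+ 2).
  by apply: ln_prod => i; case/andP: (H (lift ord0 i)).
have : \sum_(i < n) ln (S (lift ord0 i) (lift ord0 i) ^+ 2) <=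
    \sum_(i < n) (ln (Z t * v) - 1 + (Z t * v)^-1 * N t (lift ord0 i) (lift ord0 i)).
  apply: ler_sum => i _; have /andP[a0 aN] := H (lift ord0 i).
  move: a0 aN; set a := S _ _ ^+ 2 => a0 aN.
  have := ln_le_subr1 (divr_gt0 a0 Zv); rewrite ln_div ?posrE// => h.
  have : (Z t * v)^-1 * a <= (Z t * v)^-1 * N t (lift ord0 i) (lift ord0 i).
    by rewrite ler_wpM2l// invr_ge0 ltW.
  by rewrite [_^-1 * a]mulrC; lra.
rewrite big_split/= -mulr_sumr (moment_diag_sum (ltW t0)) sumr_const card_ord.
have -> : (Z t * v)^-1 * R1 t = n%:R by rewrite /v; field; rewrite !gt_eqF.
rewrite -mulr_natl lnM ?posrE// -natr1; lra.
Qed.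

(** Means under the normalized tilted probability. *)
Lemma EFin_tilted_mean t g : wintegrable t g ->
  (\int[mu]_x (g x * (gauss_weight t x / Z t))%:E = (wint t g / Z t)%:E)%E.
Proof.
move=> ig; rewrite [in RHS]mulrC -wintZ// EFin_wint; last exact: wintegrableZ.
by apply: eq_integral => x _; congr EFin; ring.
Qed.

(** The right-hand side is the derivative at [t] of
    [ln det N - (n + 1) ln Z - h / 2 + D n t / 2].  It is nonnegative because the
    variance of [q - |x|^2] is, where [q] is the squared norm of the whitened vector. *)
Lemma key_inequality t (D : R) : (0 < n)%N -> 0 < t ->
  log_concave_measure mu -> (thin_shell2 R n <= (2 * D)%:E)%E ->
  0 <= \tr (N' t *m \adj (N t)) / \det (N t) + n.+1%:R / 2 * (R1 t / Z t)
    + (wint t (fun x => sqnorm x * sqnorm x) / Z t - (R1 t / Z t) ^+ 2) / 4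
    + D * n%:R / 2.
Proof.
move=> n0 t0 lmu ts; have [S [T [tS tT pT ST NE]]] := cholesky (posdef_moment iso t0).
have [_ S0 _ TNT adjN] := cholesky_moment t0 tS tT pT ST NE.
have Zp := mass_gt0 t0; have dp := det_moment_gt0 t0.
pose Yh i x := \sum_k T i k * aug x k.
have sYh i : subexp (Yh i).
  by apply: subexp_sum => k; apply: subexpM; [exact: subexp_cst|exact: subexp_aug].
have YY i j : wint t (fun x => Yh i x * Yh j x) = (i == j)%:R.
  have := congr1 (fun M : 'M[R]_n.+1 => M i j) TNT.
  rewrite moment_congr => [|k l]; last by apply: wintegrable_moment => //; exact: ltW.
  by rewrite mxE => <-; apply: eq_wint => x; rewrite mulr1.
have s1 : subexp one by exact: subexp_cst.
have sr : subexp (@sqnorm R n) by apply: quad_subexp; exact: quad_sqnorm.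
have Y0 x : Yh 0 x = T 0 0.
  rewrite /Yh big_ord_recl aug0 mulr1 big1 ?addr0// => k _.
  by have /is_trig_mxP -> := tT; rewrite ?mul0r.
have TZ : T 0 0 ^+ 2 = (Z t)^-1.
  by rewrite -S0 (pT 0).2 exprVn invrK.
pose s := Num.sqrt (Z t).
have sp : 0 < s by rewrite sqrtr_gt0.
have s2 : s * s = Z t by rewrite -expr2 sqr_sqrtr// ltW.
(* [Yh] whitens [(1, x)] for the unnormalized weight, and its first coordinate is
   constant.  The other ones, multiplied by [sqrt Z], are an affine function of [x]
   which is isotropic for the normalized weight. *)
pose T1 : 'M[R]_n := \matrix_(i, j) (s * T (lift ord0 i) (lift ord0 j)).
pose b1 : 'cV[R]_n := \col_i (s * T (lift ord0 i) 0).
have YE x i : tnth (aff T1 b1 x) i = s * Yh (lift ord0 i) x.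
  rewrite tnth_mktuple mxE /Yh big_ord_recl aug0 mulr1 mulrDr addrC; congr (_ + _).
  by rewrite mulr_sumr; apply: eq_bigr => k _; rewrite mxE augS mulrA.
pose q x := sqnorm (aff T1 b1 x).
have qE x : q x = \sum_(i < n) Z t * (Yh (lift ord0 i) x * Yh (lift ord0 i) x).
  by apply: eq_bigr => i _; rewrite YE expr2 mulrACA s2.
have sq : subexp q.
  rewrite (_ : q = fun x => \sum_(i < n) Z t * (Yh (lift ord0 i) x * Yh (lift ord0 i) x)).
    by apply: subexp_sum => i; apply: subexpM; [exact: subexp_cst|exact: subexpM].
  by apply/funext => x; exact: qE.
have TS : wint t (fun x => (q x - n%:R) * (q x - n%:R)) / Z t <= 2 * D * n%:R.
  have pTl i : 0 < T1 i i by rewrite mxE mulr_gt0//; case: (pT (lift ord0 i)).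
  have trT1 : is_trig_mx T1.
    apply/is_trig_mxP => i j ij; rewrite mxE; have /is_trig_mxP -> := tT; by rewrite ?mulr0.
  have := @thin_shell_affine R n mu (t / 2) (Z t) D T1 b1 _ Zp trT1 pTl n0 lmu ts.
  rewrite divr_ge0 ?(ltW t0)// => /(_ isT) /=.
  have iq (g : n.-tuple R -> R) : subexp g -> wintegrable t g by exact: integrable_subexp.
  under eq_integral do rewrite -[X in X%:E]mul1r.
  rewrite EFin_tilted_mean; last exact: iq.
  rewrite divff ?gt_eqF// => /(_ erefl) H.
  have {}H := H _ _.
  rewrite -lee_fin -EFin_tilted_mean; last first.
    by apply: iq; apply: subexpM; apply: subexpD => //; exact: subexp_cst.
  under eq_integral do rewrite -expr2.
  apply: H => [i|i j].
    under eq_integral do rewrite YE.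
    rewrite (EFin_tilted_mean (g := fun x => s * Yh (lift ord0 i) x)); last first.
      by apply: iq; apply: subexpM => //; exact: subexp_cst.
    rewrite wintZ; last exact: iq.
    have := YY (lift ord0 i) 0; rewrite /=.
    rewrite (eq_wint _ _ (h := fun x => T 0 0 * Yh (lift ord0 i) x)); last first.
      by move=> x; rewrite Y0 mulrC.
    rewrite wintZ; last exact: iq.
    move=> /eqP; rewrite mulf_eq0 (gt_eqF (pT 0).1)/= => /eqP ->.
    by rewrite mulr0 mul0r.
  under eq_integral do rewrite !YE [X in X * _]mulrACA s2.
  rewrite (EFin_tilted_mean (g := fun x => Z t * (Yh (lift ord0 i) x * Yh (lift ord0 j) x))); last first.
    by apply: iq; apply: subexpM; [exact: subexp_cst|exact: subexpM].
  rewrite wintZ; last by apply: iq; exact: subexpM.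
  by rewrite YY (inj_eq (@lift_inj _ _)) mulrC mulKf// gt_eqF.
have iq (g : n.-tuple R -> R) : subexp g -> wintegrable t g by exact: integrable_subexp.
have e1 : wint t q = n%:R * Z t.
  rewrite (eq_wint _ _ qE) wint_sum => [|i]; last first.
    by apply: iq; apply: subexpM; [exact: subexp_cst|exact: subexpM].
  rewrite (eq_bigr (fun=> Z t)) => [|i _]; last first.
    by rewrite wintZ ?YY ?eqxx ?mulr1//; apply: iq; exact: subexpM.
  by rewrite sumr_const card_ord mulr_natl.
have trE : \tr (N' t *m \adj (N t)) / \det (N t) =
    - ((R1 t + wint t (fun x => q x * sqnorm x)) / Z t / 2).
  rewrite adjN -scalemxAr mxtraceZ mulrAC divff ?gt_eqF// mul1r.
  rewrite -scalemxAl mxtraceZ mulmxA mxtrace_mulC mulmxA.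
  have ir k l : wintegrable t (fun x => aug x k * aug x l * sqnorm x).
    by apply: iq; apply: subexpM => //; apply: subexpM; exact: subexp_aug.
  rewrite /mxtrace; under eq_bigr do rewrite moment_congr//.
  rewrite big_ord_recl.
  rewrite (eq_wint _ _ (h := fun x => T 0 0 ^+ 2 * sqnorm x)) => [|x]; last first.
    by rewrite -/(Yh _ _) Y0 expr2.
  rewrite wintZ ?TZ; last exact: iq.
  have -> : wint t (fun x => q x * sqnorm x) = Z t *
     \sum_(i < n) wint t (fun x => Yh (lift ord0 i) x * Yh (lift ord0 i) x * sqnorm x).
    rewrite -wint_sum => [|i]; last by apply: iq; apply: subexpM => //; exact: subexpM.
    rewrite -wintZ; last first.
      by apply: iq; apply: subexp_sum => i; apply: subexpM => //; exact: subexpM.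
    apply: eq_wint => x; rewrite qE [LHS]mulr_suml [RHS]mulr_sumr; apply: eq_bigr => i _.
    exact: esym (mulrA _ _ _).
  by rewrite /Yh; field; rewrite gt_eqF.
rewrite trE.
set h := R1 t / Z t.
(* [n] and [h] are the means of [q] and [|x|^2]. *)
have : 0 <= wint t (fun x => ((q x - n%:R) - (sqnorm x - h)) ^+ 2) / Z t.
  by rewrite divr_ge0 ?(ltW Zp)// wint_ge0// => x; exact: sqr_ge0.
pose A x := (q x - n%:R) * (q x - n%:R).
pose B x := q x * sqnorm x.
pose C (x : n.-tuple R) := sqnorm x * sqnorm x.
have sA : subexp A by apply: subexpM; apply: subexpD => //; exact: subexp_cst.
have sB : subexp B by exact: subexpM.
have sC : subexp C by exact: subexpM.
rewrite (eq_wint _ _ (h := fun x => A x + (-2 * B x + ((2 * n%:R - 2 * h) * sqnorm x +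
   (2 * h * q x + (C x + (h ^+ 2 - 2 * h * n%:R) * one x)))))); last first.
  by move=> x; rewrite /A /B /C; ring.
rewrite !wintD ?wintZ ?e1; try (apply: iq); try by repeat first [exact: subexp_cst|apply: subexpD|apply: subexpM].
move=> H0.
have -> : wint t (fun x => q x * sqnorm x) = wint t B by [].
have -> : wint t (fun x => sqnorm x * sqnorm x) = wint t C by [].
move: TS H0; rewrite -[wint t (fun x => _)]/(wint t A) => TS.
have RE : R1 t = h * Z t by rewrite /h divfK ?gt_eqF.
set a := wint t A in TS *; set b := wint t B; set c := wint t C; rewrite RE.
have -> : (a + (- 2 * b + ((2 * n%:R - 2 * h) * (h * Z t) + (2 * h * (n%:R * Z t) +
   (c + (h ^+ 2 - 2 * h * n%:R) * Z t))))) / Z t =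
   a / Z t - 2 * (b / Z t) + 2 * n%:R * h - h ^+ 2 + c / Z t.
  by field; rewrite gt_eqF.
have -> : (h * Z t + b) / Z t = h + b / Z t by field; rewrite gt_eqF.
have nE : n.+1%:R = n%:R + 1 :> R by rewrite -natr1.
rewrite nE; lra.
Qed.
End key.

(** * Second moment and Laplace transform *)

(** The derivative is only needed on [t > 0]; continuity up to [0] is expressed
    through the absolute value. *)
Lemma nondecreasing_from0 (R : realType) (F dF : R -> R) (c : R) : 0 < c ->
  continuous (fun t : R => F `|t|) -> (forall t : R, 0 < t -> is_derive t 1 F (dF t)) ->
  (forall t, 0 < t -> 0 <= dF t) -> F 0 <= F c.
Proof.
move=> c0 cF dFE dF0.
have wF : {within `[0, c], continuous F}.
  apply: (@subspace_eq_continuous _ _ _ (fun t => F `|t|)) => [t|].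
    by rewrite inE/= in_itv/= => /andP[t0 _]; rewrite /= ger0_norm.
  exact: continuous_subspaceT.
have [t|t tc FE] := @MVT R F dF 0 c c0 _ wF.
  by rewrite in_itv/= => /andP[t0 _]; exact: dFE.
rewrite -subr_ge0 FE mulr_ge0 ?subr0 ?(ltW c0)//.
by move: tc; rewrite in_itv/= => /andP[t0 _]; exact: dF0.
Qed.

Section flow.
Variables (R : realType) (n : nat) (mu : probability (n.-tuple R) R) (D : R).
Hypotheses (n0 : (0 < n)%N) (D0 : 0 < D).
Hypotheses (iso : isotropic mu) (lmu : log_concave_measure mu)
  (ts : (thin_shell2 R n <= (2 * D)%:E)%E).
Local Notation wint := (wint mu).
Local Notation one := (fun _ : n.-tuple R => (1 : R)).
Local Notation N t := (moment mu t one).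
Local Notation Z t := (wint t one).
Local Notation R1 t := (wint t (@sqnorm R n)).

Lemma mass0 : Z 0 = 1.
Proof. by rewrite -moment_corner moment_at0// mxE. Qed.

Lemma second_moment0 : R1 0 = n%:R.
Proof.
rewrite -(moment_diag_sum iso)//; under eq_bigr do rewrite moment_at0// mxE eqxx.
by rewrite sumr_const card_ord.
Qed.

Let Zp (t : R) : 0 <= t -> 0 < Z t.
Proof.
by rewrite le_eqVlt => /predU1P[<-|]; [rewrite mass0|exact: mass_gt0].
Qed.

Let dp (t : R) : 0 <= t -> 0 < \det (N t).
Proof.
by rewrite le_eqVlt => /predU1P[<-|]; [rewrite moment_at0// det1|exact: det_moment_gt0].
Qed.

Let np : 0 < n%:R :> R. Proof. by rewrite ltr0n. Qed.

Let cZ : continuous (fun t : R => Z `|t|).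
Proof. by apply: continuous_wint; [exact: integrable_sqnorm|exact: quad_cst]. Qed.

Let cR1 : continuous (fun t : R => R1 `|t|).
Proof. by apply: continuous_wint; [exact: integrable_sqnorm|exact: quad_sqnorm]. Qed.

Let cN i j : continuous (fun t : R => N `|t| i j).
Proof.
under eq_fun do rewrite mxE; apply: continuous_wint; first exact: integrable_sqnorm.
by under eq_fun do rewrite mulr1; exact: quad_aug.
Qed.

Let dZ (t : R) : 0 < t -> is_derive t 1 (fun s => Z s) (- (R1 t / 2)).
Proof.
move=> t0; rewrite (eq_wint _ _ (h := fun x => 1 * sqnorm x)) => [|x]; last by rewrite mul1r.
by apply: is_derive_wint => //; exact: subexp_cst.
Qed.

Let dR1 (t : R) : 0 < t ->
  is_derive t 1 (fun s => R1 s) (- (wint t (fun x => sqnorm x * sqnorm x) / 2)).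
Proof.
by move=> t0; apply: is_derive_wint => //; apply: quad_subexp; exact: quad_sqnorm.
Qed.

Let ddet (t : R) : 0 < t -> is_derive t 1 (fun s => \det (N s))
  (\tr (- 2^-1 *: moment mu t (@sqnorm R n) *m \adj (N t))).
Proof.
move=> t0; apply: is_derive_det => i j; rewrite !mxE.
under eq_fun do rewrite mxE.
have := @is_derive_wint R n mu t (fun x => aug x i * aug x j * 1) t0.
move=> /(_ _)/is_derive_eq; apply.
  by under eq_fun do rewrite mulr1; apply: quad_subexp; exact: quad_aug.
rewrite mulNr mulrC; congr (- (_ * _)).
by apply: eq_wint => x; rewrite mulr1.
Qed.

(** The quantity that [key_inequality] shows to be nondecreasing. *)
Let U (t : R) := ln (\det (N t)) - n.+1%:R * ln (Z t) - R1 t / Z t / 2 + D * n%:R / 2 * t.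

Let cU : continuous (fun t : R => U `|t|).
Proof.
move=> t; have t0 := normr_ge0 t.
have lnZ : {for t, continuous (fun t => ln (Z `|t|))}.
  by apply: continuous_comp; [exact: cZ|exact/continuous_ln/Zp].
apply: cvgD; last by apply: cvgM; [exact: cvg_cst|exact: norm_continuous].
apply: cvgB; last first.
  apply: cvgM; last exact: cvg_cst.
  by apply: cvgM; [exact: cR1|apply: cvgV; [rewrite gt_eqF// Zp|exact: cZ]].
apply: cvgB; last by apply: cvgM; [exact: cvg_cst|exact: lnZ].
by apply: continuous_comp; [exact: continuous_det|exact/continuous_ln/dp].
Qed.

Let dU (t : R) : 0 < t -> is_derive t 1 U
  (\tr (- 2^-1 *: moment mu t (@sqnorm R n) *m \adj (N t)) / \det (N t)
    + n.+1%:R / 2 * (R1 t / Z t)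
    + (wint t (fun x => sqnorm x * sqnorm x) / Z t - (R1 t / Z t) ^+ 2) / 4
    + D * n%:R / 2).
Proof.
move=> t0; have Zt := Zp (ltW t0); have dt := dp (ltW t0).
have L1 := is_derive1_comp (is_derive1_ln dt) (ddet t0).
have L2 := is_derive1_comp (is_derive1_ln Zt) (dZ t0).
have L3 := @is_deriveV _ _ _ _ _ (lt0r_neq0 Zt) (dZ t0).
have L4 := is_deriveM (dR1 t0) L3.
have L5 : is_derive t 1 ((D * n%:R / 2) *: id) ((D * n%:R / 2) *: 1) by exact: is_deriveZ.
have := is_deriveD (is_deriveB (is_deriveB L1 (is_deriveZ n.+1%:R L2)) (is_deriveZ 2^-1 L4)) L5.
rewrite (_ : _ + _ = U); last first.
  apply/funext => s; rewrite /U /= !fctE /= /GRing.scale/=.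
  by rewrite [2^-1 * _]mulrC.
move=> /is_derive_eq; apply.
set tr := \tr _; rewrite /GRing.scale/=.
by field; rewrite !gt_eqF.
Qed.

(** The monotone quantity [U] bounds [ln det N] from below, [ln_det_moment_le] bounds
    it from above; the two bounds combine through [ln v <= v - 1]. *)
Lemma second_moment_ge c : 0 < c -> n%:R * expR (- (D * c)) <= R1 c / Z c.
Proof.
move=> c0.
have := nondecreasing_from0 c0 cU dU (fun (t : R) (t0 : 0 < t) => key_inequality iso n0 t0 lmu ts).
have := ln_det_moment_le iso n0 c0.
rewrite /U moment_at0// det1 ln1 mass0 ln1 second_moment0 mulr0 subr0 sub0r divr1 mulr0 addr0.
set v := R1 c / Z c / n%:R => H1 H2.
have vp : 0 < v by rewrite !divr_gt0//; [exact: second_moment_gt0|exact/Zp/ltW].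
have hE : R1 c / Z c = n%:R * v by rewrite /v [RHS]mulrC divfK// gt_eqF.
rewrite hE ler_pM2l// -ler_ln ?posrE ?expR_gt0// expRK.
have H3 := ln_le_subr1 vp.
have : n%:R * (- (D * c)) <= n%:R * ln v.
  have : n%:R * ln v <= n%:R * (v - 1) by rewrite ler_pM2l.
  by move: H1 H2; rewrite hE; lra.
by rewrite ler_pM2l.
Qed.

(** The gap in the bound on [ln Z], nonnegative because it vanishes at [0] and is
    nondecreasing. *)
Let V (t : R) := - ln (Z t) - n%:R / (2 * D) * (1 - expR (- (D * t))).

(** [Z] is the Laplace transform of [|x|^2 / 2]; the derivative of [ln Z] is minus half
    the mean of [|x|^2]. *)
Lemma laplace_le c : 0 < c ->
  Z c <= expR (- (n%:R / (2 * D) * (1 - expR (- (D * c))))).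
Proof.
move=> c0.
have cV : continuous (fun t : R => V `|t|).
  move=> t; have t0 := normr_ge0 t.
  apply: cvgB.
    apply: cvgN; apply: (@continuous_comp _ _ _ (fun t : R => Z `|t|) (@ln R)).
      exact: cZ.
    exact/continuous_ln/Zp.
  apply: cvgM; first exact: cvg_cst.
  apply: cvgB; first exact: cvg_cst.
  apply: (@continuous_comp _ _ _ (fun t : R => - (D * `|t|)) expR); last exact: continuous_expR.
  by apply: cvgN; apply: cvgM; [exact: cvg_cst|exact: norm_continuous].
have dV (t : R) : 0 < t -> is_derive t 1 V
    ((R1 t / Z t - n%:R * expR (- (D * t))) / 2).
  move=> t0; have Zt := Zp (ltW t0).
  have L2 := is_derive1_comp (is_derive1_ln Zt) (dZ t0).
  have L5 : is_derive t 1 ((- D) *: id) ((- D) *: 1) by exact: is_deriveZ.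
  have L6 := is_derive1_comp (is_derive_expR _) L5.
  have L7 : is_derive t 1 (cst (1 : R)) 0 by exact: is_derive_cst.
  have := is_deriveB (is_deriveN L2) (is_deriveZ (n%:R / (2 * D)) (is_deriveB L7 L6)).
  rewrite (_ : _ - _ = V); last first.
    by apply/funext => s; rewrite /V /= !fctE /= /GRing.scale/= mulNr.
  move=> /is_derive_eq; apply; rewrite /GRing.scale/= mulNr.
  have -> : (- D *: t : R) = - (D * t) by rewrite /GRing.scale/= mulNr.
  by field; rewrite !gt_eqF.
have := nondecreasing_from0 c0 cV dV.
rewrite /V mulr0 oppr0 expR0 mass0 ln1 subrr mulr0 subr0 oppr0 => H.
rewrite -ler_ln ?posrE ?expR_gt0 ?Zp ?(ltW c0)// expRK.
rewrite -subr_ge0 [leRHS]addrC; apply: H => t t0.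
by rewrite divr_ge0// subr_ge0 second_moment_ge.
Qed.
End flow.

(** * Small balls *)

Lemma chernoff (R : realType) n (mu : probability (n.-tuple R) R) (c a : R) :
  0 < c -> 0 <= a ->
  (mu [set x | (enorm x <= a)%R] <= (expR (c / 2 * a ^+ 2) * wint mu c (fun=> 1))%:E)%E.
Proof.
move=> c0 a0; set B := [set x | _].
have me : measurable_fun setT (@enorm R n).
  apply: measurableT_comp; last exact: measurable_sqnorm.
  exact: continuous_measurable_fun (@sqrt_continuous R).
have mB : measurable B.
  have -> : B = @enorm R n @^-1` `]-oo, a] by apply/seteqP; split => x; rewrite /B/= in_itv.
  by rewrite -[X in measurable X]setTI; apply: me.
have i1 : wintegrable mu c (fun=> 1) by apply: integrable_subexp => //; exact: subexp_cst.
rewrite -wintZ// EFin_wint; last exact: wintegrableZ.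
rewrite -(setIT B) -integral_indic//; apply: ge0_le_integral => //.
- by apply/measurable_EFinP; exact: measurable_indic.
- by apply/measurable_EFinP; apply: measurable_funM => //; exact: measurable_gauss_weight.
move=> x _; rewrite lee_fin indicE mulr1 /gauss_weight -expRD.
have [xB|xB] := boolP (x \in B); last by rewrite expR_ge0.
move: xB; rewrite inE /B/= => xa.
rewrite /= -[leLHS]expR0 ler_expR -mulrBr mulr_ge0 ?divr_ge0 ?(ltW c0)// subr_ge0.
by rewrite -enormE lerXn2r ?nnegrE// sqrtr_ge0.
Qed.

Lemma small_ball (R : realType) n (mu : probability (n.-tuple R) R) (D eps : R) :
  (0 < n)%N -> 0 < D -> isotropic mu -> log_concave_measure mu ->
  (thin_shell2 R n <= (2 * D)%:E)%E -> 0 < eps < 1 ->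
  (mu [set x | (enorm x <= eps * Num.sqrt n%:R)%R]
     <= (expR (- (n%:R / (2 * D))
               * (1 - eps ^+ 2 + eps ^+ 2 * ln (eps ^+ 2))))%:E)%E.
Proof.
move=> n0 D0 iso lmu ts /andP[e0 e1].
have u0 : 0 < eps ^+ 2 by rewrite exprn_gt0.
have lnu : ln (eps ^+ 2) < 0 by rewrite ln_lt0// u0 exprn_ilt1// ltW.
(* The optimal parameter: [exp (- D c) = eps ^ 2]. *)
pose c := - ln (eps ^+ 2) / D.
have c0 : 0 < c by rewrite divr_gt0// oppr_gt0.
have a0 : 0 <= eps * Num.sqrt n%:R by rewrite mulr_ge0 ?sqrtr_ge0// ltW.
apply: le_trans (chernoff mu c0 a0) _; rewrite lee_fin.
apply: le_trans (ler_wpM2l (expR_ge0 _) (laplace_le n0 D0 iso lmu ts c0)) _.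
rewrite -expRD ler_expR exprMn sqr_sqrtr//.
have -> : - (D * c) = ln (eps ^+ 2) by rewrite /c; field; rewrite gt_eqF.
rewrite lnK ?posrE// le_eqVlt; apply/orP; left; apply/eqP.
by rewrite /c; field; rewrite gt_eqF.
Qed.

Lemma sinh_ge (R : realType) (y : R) : 0 < y -> 2 * y <= expR y - expR (- y).
Proof.
move=> y0.
pose F (t : R) := expR t - expR (- t) - 2 * t.
have cF : continuous (fun t : R => F `|t|).
  move=> t; apply: cvgB; last by apply: cvgM; [exact: cvg_cst|exact: norm_continuous].
  apply: cvgB.
    by apply: (@continuous_comp _ _ _ (fun t : R => `|t|) expR); [exact: norm_continuous|exact: continuous_expR].
  apply: (@continuous_comp _ _ _ (fun t : R => - `|t|) expR); last exact: continuous_expR.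
  by apply: cvgN; exact: norm_continuous.
have dF (t : R) : 0 < t -> is_derive t 1 F (expR t + expR (- t) - 2).
  move=> _.
  have L5 : is_derive t 1 ((- (1 : R)) *: id) (- 1 *: 1) by exact: is_deriveZ.
  have L6 := is_derive1_comp (is_derive_expR _) L5.
  have L7 : is_derive t 1 (2 *: (id : R -> R)) (2 *: 1) by exact: is_deriveZ.
  have := is_deriveB (is_deriveB (is_derive_expR t) L6) L7.
  rewrite (_ : _ - _ = F); last first.
    by apply/funext => s; rewrite /F /= !fctE /= /GRing.scale/= mulN1r.
  move=> /is_derive_eq; apply; rewrite /= /GRing.scale/=.
  have -> : (- 1 *: t : R) = - t by rewrite /GRing.scale/= mulN1r.
  by ring.
have := nondecreasing_from0 y0 cF dF.
rewrite /F oppr0 expR0 subrr mulr0 subr0 => H.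
rewrite -subr_ge0; apply: H => t _.
have := expR_ge1Dx t; have := expR_ge1Dx (- t); lra.
Qed.

(** Substitute [y = - ln x] in [sinh_ge]. *)
Lemma xlnx_ge (R : realType) (x : R) : 0 < x < 1 -> (x ^+ 2 - 1) / 2 <= x * ln x.
Proof.
move=> /andP[x0 x1]; have y0 : 0 < - ln x by rewrite oppr_gt0 ln_lt0// x0.
have := sinh_ge y0; rewrite opprK lnK ?posrE// expRN lnK ?posrE// => H.
have := ler_wpM2l (ltW x0) H.
rewrite [leRHS]mulrBr divff ?gt_eqF// -expr2; lra.
Qed.

Theorem theorem4p2 (R : realType) :
  exists2 C : R, 0 < C &
  forall (n : nat) (D : R), (1 <= n)%N -> 0 < D ->
  (thin_shell2 R n <= (2 * D)%:E)%E ->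
  forall mu : probability (n.-tuple R) R,
  log_concave_measure mu -> isotropic mu ->
  (forall eps : R, 0 < eps < 1 ->
    (mu [set x | (enorm x <= eps * Num.sqrt n%:R)%R]
     <= (expR (- (n%:R / (2 * D))
               * (1 - eps ^+ 2 + eps ^+ 2 * ln (eps ^+ 2))))%:E)%E) /\
  (forall s : R, 0 < s < Num.sqrt n%:R ->
    exists2 theta : R, `|theta| <= C * (s / Num.sqrt n%:R) &
    (mu [set x | (enorm x <= Num.sqrt n%:R - s)%R]
     <= (expR (- (s ^+ 2 / D) * (1 + theta)))%:E)%E).
Proof.
exists 2^-1 => [|n D n1 D0 ts mu lmu iso]; first by rewrite invr_gt0.
split=> [eps e01|s /andP[s0 sn]]; first exact: small_ball.
have q0 : 0 < Num.sqrt n%:R :> R by rewrite sqrtr_gt0 ltr0n.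
set q := Num.sqrt n%:R in q0 sn *.
pose t := s / q.
have t0 : 0 < t by rewrite divr_gt0.
have t1 : t < 1 by rewrite ltr_pdivrMr// mul1r.
(* With [x = 1 - t], the exponent is at least [2 t^2 - t^3 = 2 t^2 (1 - t / 2)] up to
   the factor [n / (2 D)], whence the choice of [theta]. *)
exists (- (2^-1 * t)); first by rewrite normrN ger0_norm// mulr_ge0 ?invr_ge0// ltW.
have x01 : 0 < 1 - t < 1 by lra.
have -> : q - s = (1 - t) * q by rewrite mulrBl mul1r /t divfK// gt_eqF.
apply: le_trans (small_ball n1 D0 iso lmu ts x01) _.
rewrite lee_fin ler_expR !mulNr lerN2.
have -> : s ^+ 2 / D = n%:R / (2 * D) * (2 * t ^+ 2).
  have -> : n%:R = q ^+ 2 by rewrite sqr_sqrtr.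
  by rewrite /t; field; rewrite !gt_eqF.
rewrite -(mulrA (n%:R / (2 * D))) ler_wpM2l ?divr_ge0 ?mulr_ge0 ?(ltW D0)//.
have xp : 0 < 1 - t by lra.
rewrite lnXn// -mulr_natl.
have := ler_wpM2l (ltW xp) (xlnx_ge x01).
move: (ln (1 - t)) => l; nra.
Qed.
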